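(* For each $L\in\mathbb N$ let $H_L$ be a self-adjoint operator on a $2^L$-dimensional Hilbert space whose eigenvalues, counted with multiplicity, are $E_{\boldsymbol n}=E_0+\sum_{k=1}^Ln_k\Lambda_k$, $\boldsymbol n=(n_1,\dots,n_L)\in\{0,1\}^L$, for real one-particle energies $\Lambda_1,\dots,\Lambda_L$ (possibly with repetitions) and real $E_0$ (all depending on $L$). Let $\epsilon_1,\dots,\epsilon_{L_B}$ be the distinct values among the $\Lambda_k$, with $\epsilon_j$ occurring $g_j$ times. Let $\chi(t)=\operatorname{tr}(e^{-itH_L})$. Assume that, for each $L$, $\epsilon_1,\dots,\epsilon_{L_B}$ are linearly independent over $\mathbb Q$, and that there exists $q>2$ with $$\lim_{L\to\infty}S_q^{L_B}=0,\qquad S_q^{L_B}:=\frac{\sum_{j=1}^{L_B}g_j^q}{\left(\sum_{j=1}^{L_B}g_j^2\right)^{q/2}}.$$ Then, with $t$ distributed according to the infinite time average, $$\frac{\ln\big(|\chi(t)|^2\big)}{\sqrt{\sum_{j=1}^{L_B}g_j^2}}\ \xrightarrow{d}\ \mathsf N\!\left(0,\tfrac{\pi^2}{3}\right)\quad (L\to\infty),$$ i.e. $|\chi(t)|^{2/\sqrt{\sum_jg_j^2}}$ converges in distribution to $\mathsf{LogNormal}(0,\pi^2/3)$.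
   Context: Infinite time average: $\overline{f(t)}:=\lim_{T\to\infty}\frac1T\int_0^Tf(t)\,dt$; a random variable $F(t)$ with ''$t$ distributed according to the infinite time average'' has as law the limit as $T\to\infty$ of the law of $F(t)$ with $t$ uniform on $[0,T]$. $\mathsf N(0,\sigma^2)$ denotes the centered normal distribution with variance $\sigma^2$. *)

(* Defs.v *)
From HB Require Import structures.
From mathcomp Require Import all_boot all_order all_algebra.
From mathcomp Require Import all_classical all_reals all_analysis.
Set Implicit Arguments. Unset Strict Implicit. Unset Printing Implicit Defensive.
Import Order.TTheory GRing.Theory Num.Theory.
Import numFieldNormedType.Exports.
Local Open Scope classical_set_scope.
Local Open Scope ring_scope.

Section Defs.
Context {R : realType}.

Definition occ (L : nat) := {ffun 'I_L -> bool}.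

Definition energy (L : nat) (E0 : R) (Lam : 'I_L -> R) (n : occ L) : R :=
  E0 + \sum_(k < L) (n k)%:R * Lam k.

(* |chi(t)|^2 where chi(t) = tr(e^{-itH}) = sum_n e^{-i t E_n}:
   |chi|^2 = (sum_n cos(t E_n))^2 + (sum_n sin(- t E_n))^2 *)
Definition chi_abs2 (L : nat) (E0 : R) (Lam : 'I_L -> R) (t : R) : R :=
  (\sum_(n : occ L) cos (t * energy E0 Lam n)) ^+ 2
  + (\sum_(n : occ L) sin (- (t * energy E0 Lam n))) ^+ 2.

Definition distinct_energies (L : nat) (Lam : 'I_L -> R) : seq R :=
  undup [seq Lam k | k <- enum 'I_L].

Definition mult (L : nat) (Lam : 'I_L -> R) (v : R) : nat :=
  #|[set k : 'I_L | Lam k == v]|.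

Definition Q_lin_indep (s : seq R) : Prop :=
  forall c : 'I_(size s) -> rat,
    \sum_(i < size s) ratr (c i) * s`_i = 0 -> forall i, c i = 0.

Definition sum_g2 (L : nat) (Lam : 'I_L -> R) : R :=
  \sum_(v <- distinct_energies Lam) ((mult Lam v)%:R) ^+ 2.

Definition S_q (q : R) (L : nat) (Lam : 'I_L -> R) : R :=
  (\sum_(v <- distinct_energies Lam) ((mult Lam v)%:R) `^ q)
  / (sum_g2 Lam) `^ (q / 2).

Definition time_avg_is (f : R -> R) (a : R) : Prop :=
  (fun T : R => T^-1 * Rintegral lebesgue_measure `[0, T] f) @ +oo --> a.

(* convergence in distribution, with t distributed according to the infinite
   time average, of F L to the law N(0, s^2): for every bounded continuous
   test function g, the infinite time average of g (F L t) exists for every L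
   and these averages converge to E[g(X)], X ~ N(0, s^2). *)
Definition time_avg_cvg_in_law_normal (F : nat -> R -> R) (s : R) : Prop :=
  forall g : R -> R, continuous g -> (exists M : R, forall x, `|g x| <= M) ->
  exists a : nat -> R,
    (forall L, time_avg_is (fun t => g (F L t)) (a L)) /\
    a @ \oo --> Rintegral lebesgue_measure setT
                  (fun x => g x * normal_pdf 0 s x).

End Defs.

(* Main.v *)
Require Import Defs.
From HB Require Import structures.
From mathcomp Require Import all_boot all_order all_algebra.
From mathcomp Require Import all_classical all_reals all_analysis.
From mathcomp Require Import measurable_realfun ring lra zify.
From mathcomp Require complex.
Import Order.TTheory GRing.Theory Num.Theory.
Import numFieldNormedType.Exports.
Local Open Scope classical_set_scope.
Local Open Scope ring_scope.
Set Implicit Arguments. Unset Strict Implicit. Unset Printing Implicit Defensive.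

(** Since [|1 + e^{-i x}|^2 = 2 + 2 cos x], one has
    [ln |chi t|^2 = \sum_v g_v X (v t)] with [X x = ln (2 + 2 cos x)], and by
    rational independence the [X (v t)] behave under the time average like
    independent variables, [X] having the cosine series
    [\sum_k 2 (-1)^(k-1) cos (k x) / k], of mean [0] and variance
    [2 zeta(2) = pi^2 / 3].

    The mean [um] of [|X - f_r|], where [f_r x = ln (1 + 2 r cos x + r^2)] is the
    Abel regularisation, is at most [2 |ln r|]: indeed [X <= f_r - ln r]
    pointwise, [f_r] has mean [0], and by Fatou the mean of [X] is at least [0].
    Hence, by orthogonality, truncating the cosine series at order [N] moves the
    normalised sum by [O(N^(-1/2))] in mean, uniformly in [L].  For the truncated
    sum, a trigonometric polynomial in independent frequencies, Lindeberg's
    replacement on the test functions [cos (xi x + al)] gives an error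
    [O(\sum_v |c_v|^3) = O(max_v c_v)], [c_v = g_v / (\sum g^2)^(1/2)], and
    [c_v^q <= S_q].  Finally a bounded continuous test function is
    approximated by trigonometric polynomials up to [e + C |x| / K]. *)

(** * Weierstrass approximation *)

(** The time average is only a limit of means, not a countably additive probability, so independence
    is never expressed by a product measure: it appears as the vanishing of the mean of
    [cos (z v t) f t] for [f] almost periodic with spectrum in a group that avoids the non-zero
    integer multiples of [v]. Composition with continuous functions must then preserve almost
    periodicity, whence the polynomial approximation. The obstacle is that [X (v t)] is unbounded
    near its logarithmic singularities, hence not almost periodic; it is approximated only in upper
    mean, and such errors add up over a number of frequencies that is unbounded in [L].
    Orthogonality gives bounds free of that number, but it is available only for trigonometric
    polynomials. The regularisation [f_r] bridges the two: with [L] fixed, [r] may be taken so close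
    to [1] that the summed error in mean is negligible, and what is left is a polynomial measured in
    mean square. The existence of the averages at each [L], part of the claim, comes from the same
    approximations through the Cauchy criterion. *)

Section Weierstrass.
Context {R : realType}.
Implicit Types (f : R -> R) (phi : nat -> R) (x : R).

(* Bernstein polynomial: [bern n phi = \sum_k 'C(n, k) phi k X^k (1 - X)^(n - k)]. *)
Fixpoint bern (n : nat) phi : {poly R} :=
  if n is m.+1 then (1 - 'X) * bern m phi + 'X * bern m (phi \o succn)
  else (phi 0%N)%:P.

Lemma bernS n phi x : (bern n.+1 phi).[x] =
  (1 - x) * (bern n phi).[x] + x * (bern n (phi \o succn)).[x].
Proof. by rewrite /= !hornerE. Qed.

Lemma bern_cst n c x : (bern n (fun=> c)).[x] = c.
Proof.
elim: n => [|n IH]; first by rewrite /= hornerE.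
by rewrite bernS IH; ring.
Qed.

Lemma bernD n phi psi x :
  (bern n (phi \+ psi)).[x] = (bern n phi).[x] + (bern n psi).[x].
Proof.
elim: n phi psi => [|n IH] phi psi; first by rewrite /= !hornerE.
by rewrite !bernS -[(phi \+ psi) \o _]/((phi \o succn) \+ (psi \o succn)) !IH;
  ring.
Qed.

Lemma bernZ n c phi x : (bern n (fun k => c * phi k)).[x] = c * (bern n phi).[x].
Proof.
elim: n phi => [|n IH] phi; first by rewrite /= !hornerE.
by rewrite !bernS IH -[_ \o succn]/(fun k => c * (phi \o succn) k) IH; ring.
Qed.

Lemma ler_bern n phi psi x : 0 <= x <= 1 -> (forall k, (k <= n)%N -> phi k <= psi k) ->
  (bern n phi).[x] <= (bern n psi).[x].
Proof.
move=> /andP[x0 x1]; elim: n phi psi => [|n IH] phi psi le_phi.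
  by rewrite /= !hornerE le_phi.
rewrite !bernS lerD// ler_wpM2l ?subr_ge0 ?IH//= => k kn; apply: le_phi => //.
exact: leqW.
Qed.

(** Second moment about [a] of a binomial variable: variance plus squared bias. The centre is
    arbitrary because the induction shifts [k] by one, hence [a] to [a - 1]. *)
Lemma bern_var n a x : (bern n (fun k => (k%:R - a) ^+ 2)).[x] =
  n%:R * x * (1 - x) + (n%:R * x - a) ^+ 2.
Proof.
elim: n a => [|n IH] a; first by rewrite /= hornerE; ring.
rewrite bernS IH.
have -> : (fun k : nat => (k%:R - a) ^+ 2) \o succn =
          (fun k : nat => (k%:R - (a - 1)) ^+ 2 : R).
  by apply/funext => k /=; rewrite -natr1; congr (_ ^+ 2); ring.
by rewrite IH -natr1; ring.
Qed.

Lemma unif_continuous_segment f (a b e : R) : continuous f -> 0 < e ->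
  exists2 d, 0 < d & forall x y, a <= x <= b -> `|x - y| < d -> `|f x - f y| < e.
Proof.
move=> cf e0.
have /compact_near_coveringP := @segment_compact R a b.
move=> /(_ R (0^'+) (fun d x => forall y, `|x - y| < d -> `|f x - f y| < e) _)[].
  move=> x _.
  have /cvgrPdist_lt/(_ (e / 2))[|d /= d0 xd] := cf x; first by rewrite divr_gt0.
  exists (ball x (d / 2), [set r : R | 0 < r < d / 2]).
    split => /=; first by exists (d / 2) => //=; rewrite divr_gt0.
    exists (d / 2) => /=; first by rewrite divr_gt0.
    move=> r /=; rewrite sub0r normrN => rd r0.
    by rewrite r0/= (le_lt_trans _ rd)// ler_norm.
  move=> [z r] [/= xz] /andP[r0 rd] y zy.
  have fz : `|f x - f z| < e / 2 by apply: xd; rewrite /ball/= (lt_trans xz)//; lra.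
  have fy : `|f x - f y| < e / 2.
    apply: xd => /=; rewrite -(subrK z x) -addrA (le_lt_trans (ler_normD _ _))//.
    by move: xz; rewrite /ball/=; lra.
  rewrite -(subrK (f x) (f z)) -addrA (le_lt_trans (ler_normD _ _))//.
  by rewrite distrC; lra.
move=> d /= d0 H; exists (d / 2); first by rewrite divr_gt0.
move=> x y xab; apply: (H (d / 2)) => //=.
- by rewrite sub0r normrN gtr0_norm; lra.
- by rewrite divr_gt0.
Qed.

(** Bernstein's argument: [|g u - phi k|] is at most [e / 2 + C (k - n u)^2], by uniform continuity
    for near points and by the square for far ones. The Bernstein operator is positive, so it
    transports this bound, and the second moment brings it below [e]. *)
Lemma weierstrass f (B e : R) : continuous f -> 0 < e ->
  exists p : {poly R}, forall x, `|x| <= B -> `|f x - p.[x]| <= e.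
Proof.
move=> cf e0.
have [B0|B0] := ltP B 0.
  by exists 0 => x xB; have := normr_ge0 x; lra.
(* The shift by one keeps [b > 0] when [B = 0]; [g] is [f] on [[-b, b]] read on [[0, 1]]. *)
pose b := B + 1; have b0 : 0 < b by rewrite /b; lra.
pose g (u : R) := f (2 * b * u - b).
have cg : continuous g.
  move=> u; apply: continuous_comp; last exact: cf.
  by apply: cvgB; [apply: cvgM; [exact: cvg_cst|exact: cvg_id]|exact: cvg_cst].
have [d d0 gd] := @unif_continuous_segment g 0 1 (e / 2) cg (divr_gt0 e0 (ltr0n _ 2)).
have [M M0 gM] : exists2 M, 0 < M & forall u, 0 <= u <= 1 -> `|g u| <= M.
  have /compact_bounded[M [_ gM]] : compact (g @` `[0, 1]).
    apply: continuous_compact; last exact: segment_compact.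
    exact: continuous_subspaceT.
  exists (`|M| + 1) => [|u u01]; first by have := normr_ge0 M; lra.
  apply: (gM (`|M| + 1)); first by have := ler_norm M; lra.
  by exists u.
(* With [n + 1] nodes above this threshold the variance term [2 M / (d^2 (n + 1))] is at most
   [e / 2]. *)
have [n nC] : exists n : nat, 4 * M / (d ^+ 2 * e) < n.+1%:R.
  by exists (Num.truncn (4 * M / (d ^+ 2 * e))); exact: truncnS_gt.
pose phi k := g (k%:R / n.+1%:R).
have n0 : 0 < n.+1%:R :> R by rewrite ltr0n.
have main u : 0 <= u <= 1 -> `|g u - (bern n.+1 phi).[u]| <= e.
  move=> u01; have /andP[u0 u1] := u01.
  pose C := 2 * M / (d ^+ 2 * n.+1%:R ^+ 2).
  have C0 : 0 <= C by rewrite /C divr_ge0 ?mulr_ge0 ?sqr_ge0// ltW.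
  have le_err k : (k <= n.+1)%N ->
      `|g u - phi k| <= e / 2 + C * (k%:R - n.+1%:R * u) ^+ 2.
    move=> kn; rewrite /phi; set v := k%:R / n.+1%:R.
    have kE : k%:R = n.+1%:R * v by rewrite /v mulrC divfK// gt_eqF.
    have [uv|uv] := ltP `|u - v| d.
      have := gd u v u01 uv.
      have : 0 <= C * (k%:R - n.+1%:R * u) ^+ 2 by rewrite mulr_ge0// sqr_ge0.
      lra.
    have v01 : 0 <= v <= 1.
      by rewrite /v divr_ge0 ?ler0n//= ler_pdivrMr// mul1r ler_nat.
    have le2M : `|g u - g v| <= 2 * M.
      by rewrite (le_trans (ler_normB _ _))//; have := gM _ u01; have := gM _ v01; lra.
    have -> : C * (k%:R - n.+1%:R * u) ^+ 2 = 2 * M * ((u - v) ^+ 2 / d ^+ 2).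
      by rewrite kE /C; field; rewrite ?gt_eqF.
    have : 1 <= (u - v) ^+ 2 / d ^+ 2.
      rewrite ler_pdivlMr ?exprn_gt0// mul1r -(real_normK (num_real (u - v))).
      by rewrite lerXn2r// nnegrE ltW.
    by move: le2M M0; move: ((u - v) ^+ 2 / d ^+ 2) `|g u - g v| => r s *; nra.
  have Hvar : (bern n.+1 (fun k => e / 2 + C * (k%:R - n.+1%:R * u) ^+ 2)).[u] <= e.
    rewrite (bernD n.+1 (fun=> e / 2) (fun k => C * (k%:R - n.+1%:R * u) ^+ 2)).
    rewrite bern_cst bernZ bern_var subrr expr0n /= addr0.
    have -> : C * (n.+1%:R * u * (1 - u)) = 2 * M / (d ^+ 2 * n.+1%:R) * (u * (1 - u)).
      by rewrite /C; field; rewrite ?gt_eqF.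
    have uu : 0 <= u * (1 - u) <= 1 by nra.
    have : 2 * M / (d ^+ 2 * n.+1%:R) <= e / 2.
      rewrite ler_pdivrMr ?mulr_gt0 ?exprn_gt0//.
      move: nC; rewrite ltr_pdivrMr ?mulr_gt0 ?exprn_gt0//; nra.
    have : 0 <= 2 * M / (d ^+ 2 * n.+1%:R).
      by rewrite divr_ge0 ?mulr_ge0 ?sqr_ge0// ltW.
    by move: (2 * M / _) (u * _) uu => r s /andP[] *; nra.
  have h1 : (bern n.+1 phi).[u] <= g u + e.
    have := @ler_bern n.+1 phi ((fun=> g u) \+
      (fun k => e / 2 + C * (k%:R - n.+1%:R * u) ^+ 2)) u u01.
    rewrite bernD bern_cst => /(_ _)/le_trans; apply; last by rewrite lerD2l.
    by move=> k /le_err; rewrite /= ler_norml => /andP[]; lra.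
  have h2 : g u <= (bern n.+1 phi).[u] + e.
    have := @ler_bern n.+1 (fun=> g u) (phi \+
      (fun k => e / 2 + C * (k%:R - n.+1%:R * u) ^+ 2)) u u01.
    rewrite bernD bern_cst => /(_ _)/le_trans; apply; last by rewrite lerD2l.
    by move=> k /le_err; rewrite /= ler_norml => /andP[]; lra.
  by rewrite ler_norml; apply/andP; split; lra.
exists (bern n.+1 phi \Po ('X * (2 * b)^-1%:P + 2^-1%:P)) => x xB.
rewrite horner_comp.
have -> : ('X * (2 * b)^-1%:P + 2^-1%:P).[x] = x * (2 * b)^-1 + 2^-1.
  by rewrite !hornerE.
have -> : f x = g (x * (2 * b)^-1 + 2^-1).
  by rewrite /g; congr f; field; rewrite gt_eqF.
apply: main; move: xB; rewrite ler_norml => /andP[xB1 xB2].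
have -> : x * (2 * b)^-1 + 2^-1 = (x + b) / (2 * b) by field; rewrite gt_eqF.
rewrite divr_ge0 ?ler_pdivrMr ?mul1r ?mulr_gt0 ?mulr_ge0//=; rewrite /b in b0 *; lra.
Qed.
End Weierstrass.

(** * Uniformly almost periodic functions *)

Section AlmostPeriodic.
Context {R : realType}.
Implicit Types (f g : R -> R) (Om : set R) (s : seq (R * R * R)).

(** Entries are amplitude, frequency and phase; phases take the place of sines and of complex
    exponentials. *)
Definition trigsum s (t : R) : R :=
  \sum_(z <- s) z.1.1 * cos (z.1.2 * t + z.2).

(* Bohr almost periodicity with spectrum in [Om]. *)
Definition ap Om f := forall e, 0 < e ->
  exists2 s, (forall z, z \in s -> Om z.1.2) & forall t, `|f t - trigsum s t| <= e.

Lemma trigsum_cat s1 s2 t : trigsum (s1 ++ s2) t = trigsum s1 t + trigsum s2 t.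
Proof. by rewrite /trigsum big_cat. Qed.

Lemma cosM (x y : R) : cos x * cos y = (cos (x + y) + cos (x - y)) / 2.
Proof. by rewrite cosD cosB; field. Qed.

Lemma trigsumMcos s c v a t : c * cos (v * t + a) * trigsum s t =
  trigsum ([seq (c * z.1.1 / 2, v + z.1.2, a + z.2) | z <- s] ++
           [seq (c * z.1.1 / 2, v - z.1.2, a - z.2) | z <- s]) t.
Proof.
rewrite trigsum_cat /trigsum !big_map mulr_sumr -big_split/=; apply: eq_bigr => z _.
have -> : (v + z.1.2) * t + (a + z.2) = (v * t + a) + (z.1.2 * t + z.2) by ring.
have -> : (v - z.1.2) * t + (a - z.2) = (v * t + a) - (z.1.2 * t + z.2) by ring.
transitivity (c * z.1.1 * (cos (v * t + a) * cos (z.1.2 * t + z.2))); first by ring.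
by rewrite cosM; field.
Qed.

Lemma trigsum_le s t : `|trigsum s t| <= \sum_(z <- s) `|z.1.1|.
Proof.
rewrite (le_trans (ler_norm_sum _ _ _))// ler_sum// => z _.
by rewrite normrM ler_piMr// cos_max.
Qed.

Lemma continuous_cos_affine (w a : R) : continuous (fun t : R => cos (w * t + a)).
Proof.
move=> t; apply: (@continuous_comp _ _ _ (fun t => w * t + a) cos).
  by apply: cvgD; [apply: cvgM; [exact: cvg_cst|exact: cvg_id]|exact: cvg_cst].
exact: continuous_cos.
Qed.

Lemma continuous_trigsum s : continuous (trigsum s).
Proof.
elim: s => [|z s IH] t.
  rewrite [trigsum _](_ : _ = fun=> 0); first exact: cvg_cst.
  by apply/funext => x; rewrite /trigsum big_nil.
rewrite [trigsum _](_ : _ =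
    (fun x => z.1.1 * cos (z.1.2 * x + z.2) + trigsum s x)); last first.
  by apply/funext => x; rewrite /trigsum big_cons.
apply: cvgD; last exact: IH.
by apply: cvgM; [exact: cvg_cst|exact: continuous_cos_affine].
Qed.

Lemma ap_cos Om w a : Om w -> ap Om (fun t => cos (w * t + a)).
Proof.
move=> Omw e e0; exists [:: (1, w, a)].
  by move=> z; rewrite inE => /eqP ->.
by move=> t; rewrite /trigsum big_seq1/= mul1r subrr normr0 ltW.
Qed.

Lemma ap_ext Om f g : f =1 g -> ap Om f -> ap Om g.
Proof. by move=> /funext ->. Qed.

Lemma ap_bounded Om f : ap Om f -> exists2 M, 0 < M & forall t, `|f t| <= M.
Proof.
move=> /(_ 1 ltr01)[s _ fs]; exists (1 + \sum_(z <- s) `|z.1.1|).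
  by rewrite ltr_pwDl// sumr_ge0.
move=> t; rewrite -(subrK (trigsum s t) (f t)) (le_trans (ler_normD _ _))//.
by rewrite lerD// trigsum_le.
Qed.

Lemma ap_uniform Om f :
  (forall e, 0 < e -> exists2 g, ap Om g & forall t, `|f t - g t| <= e) -> ap Om f.
Proof.
move=> apf e e0; have [g apg fg] := apf (e / 2) (divr_gt0 e0 (ltr0n _ 2)).
have [s sOm gs] := apg (e / 2) (divr_gt0 e0 (ltr0n _ 2)).
exists s => // t; rewrite -(subrK (g t) (f t)) -addrA (le_trans (ler_normD _ _))//.
by have := fg t; have := gs t; lra.
Qed.

Lemma apD Om f g : ap Om f -> ap Om g -> ap Om (f \+ g).
Proof.
move=> apf apg e e0.
have [s sOm fs] := apf (e / 2) (divr_gt0 e0 (ltr0n _ 2)).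
have [r rOm gr] := apg (e / 2) (divr_gt0 e0 (ltr0n _ 2)).
exists (s ++ r) => [z|t].
  by rewrite mem_cat => /orP[/sOm|/rOm].
rewrite trigsum_cat /= opprD addrACA (le_trans (ler_normD _ _))//.
by have := fs t; have := gr t; lra.
Qed.

(** Product-to-sum moves the spectrum to [v + Om] and [v - Om]. The target [Om'] is a separate set
    so that it can be one that omits [0]. *)
Lemma ap_Mcos Om Om' f c v a : ap Om f ->
  (forall w, Om w -> Om' (v + w) /\ Om' (v - w)) ->
  ap Om' (fun t => c * cos (v * t + a) * f t).
Proof.
move=> apf OmOm' e e0.
have d0 : 0 < e / (`|c| + 1) by rewrite divr_gt0// ltr_wpDl.
have [s sOm fs] := apf _ d0.
exists ([seq (c * z.1.1 / 2, v + z.1.2, a + z.2) | z <- s] ++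
        [seq (c * z.1.1 / 2, v - z.1.2, a - z.2) | z <- s]).
  by move=> z; rewrite mem_cat => /orP[] /mapP[y /sOm /OmOm' []] /= h1 h2 ->.
move=> t; rewrite -trigsumMcos -mulrBr normrM.
have := fs t; rewrite ler_pdivlMr ?ltr_wpDl// => /(le_trans _); apply.
rewrite mulrC ler_wpM2l// normrM.
by have := cos_max (v * t + a); have := normr_ge0 c; nra.
Qed.

Lemma apZ Om f c : ap Om f -> ap Om (fun t => c * f t).
Proof.
move=> apf e e0.
have d0 : 0 < e / (`|c| + 1) by rewrite divr_gt0// ltr_wpDl.
have [s sOm fs] := apf _ d0.
exists [seq (c * z.1.1, z.1.2, z.2) | z <- s] => [z /mapP[y /sOm + ->]//|t].
rewrite /trigsum big_map/= [X in _ - X](_ : _ = c * trigsum s t); last first.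
  by rewrite /trigsum mulr_sumr; apply: eq_bigr => z _; rewrite mulrA.
rewrite -mulrBr normrM; have := fs t; rewrite ler_pdivlMr ?ltr_wpDl//.
by have := normr_ge0 c; have := normr_ge0 (f t - trigsum s t); nra.
Qed.

Definition is_subgroup Om := Om 0 /\ forall x y, Om x -> Om y -> Om (x - y).

Lemma subgroupD Om x y : is_subgroup Om -> Om x -> Om y -> Om (x + y).
Proof.
move=> [Om0 OmB] Omx Omy; rewrite (_ : x + y = x - (0 - y)); last by ring.
by apply: (OmB) => //; exact: OmB.
Qed.

Lemma ap_cst Om c : is_subgroup Om -> ap Om (fun=> c).
Proof.
move=> [Om0 _]; have := apZ c (@ap_cos Om 0 0 Om0).
by apply: ap_ext => t; rewrite mul0r addr0 cos0 mulr1.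
Qed.

Lemma ap_trigsumM Om s f : is_subgroup Om -> (forall z, z \in s -> Om z.1.2) ->
  ap Om f -> ap Om (fun t => trigsum s t * f t).
Proof.
move=> OmG sOm apf; elim: s sOm => [|z s IH] sOm.
  by apply: ap_ext (ap_cst 0 OmG) => t; rewrite /trigsum big_nil mul0r.
apply: ap_ext (apD (@ap_Mcos Om Om f z.1.1 z.1.2 z.2 apf _) (IH _)).
- by move=> t /=; rewrite /trigsum big_cons mulrDl.
- move=> w Omw; have Omz : Om z.1.2 by apply: sOm; rewrite mem_head.
  by split; [exact: subgroupD|exact: (OmG.2)].
- by move=> y ys; apply: sOm; rewrite inE ys orbT.
Qed.

(** Replacing one factor by a trigonometric sum costs only the bound of the other; the group
    structure absorbs the sums and differences of frequencies. *)
Lemma apM Om f g : is_subgroup Om -> ap Om f -> ap Om g -> ap Om (f \* g).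
Proof.
move=> OmG apf apg; apply: ap_uniform => e e0.
have [M M0 gM] := ap_bounded apg.
have [s sOm fs] := apf _ (divr_gt0 e0 M0).
exists (fun t => trigsum s t * g t); first exact: ap_trigsumM.
move=> t; rewrite -mulrBl normrM; have := fs t; rewrite ler_pdivlMr//.
by move=> /(le_trans _); apply; rewrite ler_wpM2l.
Qed.

Lemma ap_poly Om f (p : {poly R}) : is_subgroup Om -> ap Om f ->
  ap Om (fun t => p.[f t]).
Proof.
move=> OmG apf; elim/poly_ind: p => [|p c IH].
  by apply: ap_ext (ap_cst 0 OmG) => t; rewrite horner0.
apply: ap_ext (apD (apM OmG IH apf) (ap_cst c OmG)) => t.
by rewrite hornerMXaddC.
Qed.

(** The range of [f] is bounded, and there [phi] is a uniform limit of polynomials. *)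
Lemma ap_comp Om f (phi : R -> R) : is_subgroup Om -> continuous phi -> ap Om f ->
  ap Om (phi \o f).
Proof.
move=> OmG cphi apf; apply: ap_uniform => e e0.
have [M _ fM] := ap_bounded apf.
have [p phip] := weierstrass M cphi e0.
by exists (fun t => p.[f t]); [exact: ap_poly|move=> t; exact: phip].
Qed.

Lemma ap_continuous Om f : ap Om f -> continuous f.
Proof.
move=> apf t; apply/cvgrPdist_le => e e0.
have [s _ fs] := apf (e / 3) (divr_gt0 e0 (ltr0n _ 3)).
have /cvgrPdist_le/(_ (e / 3) (divr_gt0 e0 (ltr0n _ 3))) := @continuous_trigsum s t.
apply: filterS => x.
move: (fs t) (fs x); rewrite !ler_norml => /andP[? ?] /andP[? ?] /andP[? ?].
by apply/andP; split; lra.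
Qed.

End AlmostPeriodic.

(** * Time averages *)

Section Averages.
Context {R : realType}.
Notation mu := (@lebesgue_measure R).
Implicit Types (f g : R -> R).

Lemma Rintegral_FTC (f F : R -> R) (a b : R) : a < b -> continuous f ->
  (forall x, is_derive x (1 : R) F (f x)) ->
  \int[mu]_(x in `[a, b]) f x = F b - F a.
Proof.
move=> ab cf dF; have cF : continuous F.
  by move=> x; apply/differentiable_continuous/derivable1_diffP; case: (dF x).
rewrite /Rintegral (continuous_FTC2 (F := F) ab)//.
- exact: continuous_subspaceT.
- split; first by move=> x _; case: (dF x).
  + exact/cvg_at_right_filter/cF.
  + exact/cvg_at_left_filter/cF.
- by move=> x _; rewrite derive1E derive_val.
Qed.

Definition lint f := forall T, mu.-integrable `[0, T] (EFin \o f).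

Definition avg (T : R) f : R := T^-1 * \int[mu]_(t in `[0, T]) f t.

Lemma lint_continuous f : continuous f -> lint f.
Proof.
move=> cf T; apply: continuous_compact_integrable; first exact: segment_compact.
exact: continuous_subspaceT.
Qed.

Lemma lint_bounded f (M : R) : measurable_fun setT f -> (forall t, `|f t| <= M) ->
  lint f.
Proof.
move=> mf fM T; apply: measurable_bounded_integrable => //.
- by rewrite /= lebesgue_measure_itv/=; case: ifP => _ //; rewrite -EFinD ltry.
- exact: measurable_funTS.
- exists M; split; first exact: num_real.
  by move=> x Mx t _; exact: (le_trans (fM t) (ltW Mx)).
Qed.

Lemma lint_cst c : lint (fun=> c).
Proof. by apply: lint_continuous => x; exact: cvg_cst. Qed.

Lemma lintD f g : lint f -> lint g -> lint (fun t => f t + g t).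
Proof. by move=> lf lg T; apply: (@integrableD _ _ _ mu _ _ (EFin \o f) (EFin \o g)). Qed.

Lemma lintB f g : lint f -> lint g -> lint (fun t => f t - g t).
Proof. by move=> lf lg T; apply: (@integrableB _ _ _ mu _ _ (EFin \o f) (EFin \o g)). Qed.

Lemma lintZ c f : lint f -> lint (fun t => c * f t).
Proof. by move=> lf T; apply: (@integrableZl _ _ _ mu _ _ c (EFin \o f)). Qed.

Lemma lint_norm f : lint f -> lint (fun t => `|f t|).
Proof. by move=> lf T; apply: (integrable_norm (lf T)). Qed.

Lemma lint_sum (I : Type) (s : seq I) (f : I -> R -> R) :
  (forall i, lint (f i)) -> lint (fun t => \sum_(i <- s) f i t).
Proof.
move=> lf; elim: s => [|i s IH].
  by under eq_fun do rewrite big_nil; exact: lint_cst.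
by under eq_fun do rewrite big_cons; exact: lintD.
Qed.

Lemma avgD T f g : lint f -> lint g ->
  avg T (fun t => f t + g t) = avg T f + avg T g.
Proof. by move=> lf lg; rewrite /avg RintegralD// mulrDr. Qed.

Lemma avgB T f g : lint f -> lint g ->
  avg T (fun t => f t - g t) = avg T f - avg T g.
Proof. by move=> lf lg; rewrite /avg RintegralB// mulrBr. Qed.

Lemma avgZ T c f : lint f -> avg T (fun t => c * f t) = c * avg T f.
Proof. by move=> lf; rewrite /avg RintegralZl// mulrCA. Qed.

Lemma avg_cst T c : 0 < T -> avg T (fun=> c) = c.
Proof.
move=> T0; rewrite /avg Rintegral_cst//= lebesgue_measure_itv/= lte_fin T0.
by rewrite /= subr0; field; rewrite gt_eqF.
Qed.

Lemma le_avg T f g : 0 < T -> lint f -> lint g -> (forall t, f t <= g t) ->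
  avg T f <= avg T g.
Proof. by move=> T0 lf lg fg; rewrite ler_pM2l ?invr_gt0// le_Rintegral. Qed.

Lemma avg_norm T f : 0 < T -> lint f -> `|avg T f| <= avg T (fun t => `|f t|).
Proof.
move=> T0 lf; rewrite normrM gtr0_norm ?invr_gt0// ler_pM2l ?invr_gt0//.
exact: le_normr_Rintegral.
Qed.

(* [um f d]: the upper mean [limsup_T avg T |f|] is at most [d]. *)
Definition um f (d : R) := forall e, 0 < e ->
  \forall T \near +oo, avg T (fun t => `|f t|) <= d + e.

Lemma um_mono f d d' : d <= d' -> um f d -> um f d'.
Proof.
by move=> dd' uf e e0; apply: filterS (uf e e0) => T /le_trans; apply; rewrite lerD2r.
Qed.

Lemma um_le f g d : lint f -> lint g -> (forall t, `|f t| <= `|g t|) ->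
  um g d -> um f d.
Proof.
move=> lf lg fg ug e e0; near=> T.
have T0 : 0 < T by near: T; exact: nbhs_pinfty_gt.
rewrite (@le_trans _ _ (avg T (fun t => `|g t|)))//.
  by apply: le_avg => //; exact: lint_norm.
by near: T; exact: ug.
Unshelve. all: by end_near. Qed.

Lemma um_bounded f d : lint f -> (forall t, `|f t| <= d) -> um f d.
Proof.
move=> lf fd e e0; near=> T.
have T0 : 0 < T by near: T; exact: nbhs_pinfty_gt.
rewrite (@le_trans _ _ d)//; last by rewrite lerDl ltW.
rewrite -[leRHS](@avg_cst T d)//; apply: le_avg => //; first exact: lint_norm.
exact: lint_cst.
Unshelve. all: by end_near. Qed.

Lemma umD f g d d' : lint f -> lint g -> um f d -> um g d' ->
  um (fun t => f t + g t) (d + d').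
Proof.
move=> lf lg uf ug e e0; near=> T.
have T0 : 0 < T by near: T; exact: nbhs_pinfty_gt.
have h1 : avg T (fun t => `|f t|) <= d + e / 2.
  by near: T; apply: uf; rewrite divr_gt0.
have h2 : avg T (fun t => `|g t|) <= d' + e / 2.
  by near: T; apply: ug; rewrite divr_gt0.
rewrite (@le_trans _ _ (avg T (fun t => `|f t| + `|g t|)))//; last first.
  by rewrite avgD; [lra|exact: lint_norm|exact: lint_norm].
apply: le_avg => //.
- by apply: lint_norm; exact: lintD.
- by apply: lintD; exact: lint_norm.
- by move=> t; exact: ler_normD.
Unshelve. all: by end_near. Qed.

Lemma umZ c f d : lint f -> um f d -> um (fun t => c * f t) (`|c| * d).
Proof.
move=> lf uf e e0; have c0 : 0 < `|c| + 1 by rewrite ltr_wpDl.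
have := uf (e / (`|c| + 1)) (divr_gt0 e0 c0); apply: filterS => T h.
have -> : (fun t => `|c * f t|) = (fun t => `|c| * `|f t|).
  by apply/funext => t; rewrite normrM.
rewrite avgZ; last exact: lint_norm.
rewrite (le_trans (ler_wpM2l (normr_ge0 c) h))// mulrDr lerD2l.
by rewrite mulrCA ler_piMr ?(ltW e0)// ler_pdivrMr// mul1r lerDl.
Qed.

Lemma time_avgP f a : time_avg_is f a <->
  forall e, 0 < e -> \forall T \near +oo, `|a - avg T f| <= e.
Proof. exact: (@cvgrPdist_le R R^o R). Qed.

Lemma time_avgD f g a b : lint f -> lint g -> time_avg_is f a -> time_avg_is g b ->
  time_avg_is (fun t => f t + g t) (a + b).
Proof.
move=> lf lg fa gb; rewrite /time_avg_is.
rewrite [X in X @ _ --> _](_ : _ = (fun T => avg T f + avg T g)).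
  exact: cvgD.
by apply/funext => T; rewrite -avgD.
Qed.

Lemma time_avgZ f c a : lint f -> time_avg_is f a -> time_avg_is (fun t => c * f t) (c * a).
Proof.
move=> lf fa; rewrite /time_avg_is.
rewrite [X in X @ _ --> _](_ : _ = (fun T => c * avg T f)).
  by apply: cvgM => //; exact: cvg_cst.
by apply/funext => T; rewrite -avgZ.
Qed.

Lemma time_avg_cst (c : R) : time_avg_is (fun=> c) c.
Proof.
apply/time_avgP => e e0; near=> T; rewrite avg_cst ?subrr ?normr0 ?ltW//.
Unshelve. all: by end_near. Qed.

Lemma time_avg_sum (I : Type) (s : seq I) (f : I -> R -> R) (a : I -> R) :
  (forall i, lint (f i)) -> (forall i, time_avg_is (f i) (a i)) ->
  time_avg_is (fun t => \sum_(i <- s) f i t) (\sum_(i <- s) a i).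
Proof.
move=> lf fa; elim: s => [|i s IH].
  by under eq_fun do rewrite big_nil; rewrite big_nil; exact: time_avg_cst.
under eq_fun do rewrite big_cons; rewrite big_cons.
by apply: time_avgD => //; exact: lint_sum.
Qed.

Lemma time_avg_le_um f a d : lint f -> time_avg_is f a -> um f d -> `|a| <= d.
Proof.
move=> lf /time_avgP fa uf; apply/ler_addgt0Pr => e e0.
near (pinfty_nbhs R) => T.
have T0 : 0 < T by near: T; exact: nbhs_pinfty_gt.
have h1 : `|a - avg T f| <= e / 2 by near: T; apply: fa; rewrite divr_gt0.
have h2 : avg T (fun t => `|f t|) <= d + e / 2.
  by near: T; apply: uf; rewrite divr_gt0.
rewrite -(subrK (avg T f) a) (le_trans (ler_normD _ _))//.
by have := avg_norm T0 lf; lra.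
Unshelve. all: by end_near. Qed.

Lemma time_avg_close f g a b d : lint f -> lint g ->
  time_avg_is f a -> time_avg_is g b -> um (fun t => f t - g t) d -> `|a - b| <= d.
Proof.
move=> lf lg fa gb; apply: time_avg_le_um; first exact: lintB.
rewrite -mulN1r; have := time_avgD lf (lintZ (-1) lg) fa (time_avgZ (c:=-1) lg gb).
by under eq_fun do rewrite mulN1r.
Qed.

(** The averages of [f] eventually lie within [e] of the limit for [g], so they satisfy the Cauchy
    criterion as [T] tends to infinity. *)
Lemma time_avg_exists f : lint f ->
  (forall e, 0 < e -> exists g, [/\ lint g, exists b, time_avg_is g b &
     um (fun t => f t - g t) e]) ->
  exists a, time_avg_is f a.
Proof.
move=> lf H.
suff /cauchy_cvgP/cvg_ex[a fa] : cauchy ((fun T => avg T f) @ +oo) by exists a.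
apply: cauchy_exP => e e0.
have e4 : 0 < e / 4 by rewrite divr_gt0.
have [g [lg [b /time_avgP gb] ufg]] := H _ e4; exists b.
change (\forall T \near +oo, ball b e (avg T f)); near=> T; rewrite /ball/=.
have T0 : 0 < T by near: T; exact: nbhs_pinfty_gt.
have h1 : `|b - avg T g| <= e / 4 by near: T; exact: gb.
have h2 : avg T (fun t => `|f t - g t|) <= e / 4 + e / 4 by near: T; exact: ufg.
have := avg_norm T0 (lintB lf lg); rewrite avgB// => h3.
move: h1 h3; rewrite !ler_norml ltr_norml => /andP[? ?] /andP[? ?].
by apply/andP; split; lra.
Unshelve. all: by end_near. Qed.
End Averages.

(** * Derivatives and Taylor bounds *)

Section DeriveRules.
Context {R : realType}.
Implicit Types (f g : R -> R) (x a b c : R).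

Lemma der_cst x c : is_derive x (1 : R) (fun=> c) 0.
Proof. exact: is_derive_cst. Qed.

Lemma der_id x : is_derive x (1 : R) (fun y => y) 1.
Proof. exact: is_derive_id. Qed.

Lemma der_D x f g a b : is_derive x (1 : R) f a -> is_derive x (1 : R) g b ->
  is_derive x (1 : R) (fun y => f y + g y) (a + b).
Proof. by move=> ? ?; exact: is_deriveD. Qed.

Lemma der_N x f a : is_derive x (1 : R) f a ->
  is_derive x (1 : R) (fun y => - f y) (- a).
Proof. by move=> ?; exact: is_deriveN. Qed.

Lemma der_M x f g a b : is_derive x (1 : R) f a -> is_derive x (1 : R) g b ->
  is_derive x (1 : R) (fun y => f y * g y) (f x * b + g x * a).
Proof. by move=> ? ?; exact: (@is_deriveM _ _ f g x 1 a b). Qed.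

Lemma der_X x f a n : is_derive x (1 : R) f a ->
  is_derive x (1 : R) (fun y => f y ^+ n) (n%:R * f x ^+ n.-1 * a).
Proof.
move=> ?; rewrite (_ : (fun y => f y ^+ n) = f ^+ n); first exact: is_deriveX.
by apply/funext => y; rewrite fctE.
Qed.

Lemma der_comp x f g a b : is_derive (f x) (1 : R) g b -> is_derive x (1 : R) f a ->
  is_derive x (1 : R) (fun y => g (f y)) (a * b).
Proof. by move=> ? ?; rewrite mulrC; exact: is_derive1_comp. Qed.

Lemma der_eq x f a b : is_derive x (1 : R) f a -> a = b -> is_derive x (1 : R) f b.
Proof. by move=> ? <-. Qed.

Lemma der_continuous f f' : (forall x, is_derive x (1 : R) f (f' x)) -> continuous f.
Proof.
move=> df x.
by apply/differentiable_continuous/derivable1_diffP; case: (df x).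
Qed.
End DeriveRules.

(* [is_derive] is a type class, whose automatic resolution would get in the way of
   these syntax-directed rules. *)
Ltac der := repeat first
  [ notypeclasses refine (der_cst _ _) | notypeclasses refine (der_id _)
  | notypeclasses refine (der_D _ _) | notypeclasses refine (der_N _)
  | notypeclasses refine (der_X _ _)
  | notypeclasses refine (der_M _ _)
  | notypeclasses refine (@der_comp _ _ _ sin _ _ (is_derive_sin _) _)
  | notypeclasses refine (@der_comp _ _ _ cos _ _ (is_derive_cos _) _)
  | notypeclasses refine (@der_comp _ _ _ expR _ _ (is_derive_expR _) _) ].

Section Taylor.
Context {R : realType}.

(** The bounds below form a ladder: each Taylor inequality for [sin] or [cos] is the derivative
    inequality needed for a later one, starting from [sin <= 1] and [cos <= 1]. *)
Lemma le_of_derive_ge0 (F f : R -> R) (y : R) : 0 <= y ->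
  (forall x, is_derive x (1 : R) F (f x)) -> (forall x, 0 <= x -> 0 <= f x) ->
  F 0 <= F y.
Proof.
move=> y0 dF f0; have [] := @MVT_segment R F f 0 y y0.
- apply: continuous_subspaceT => x; exact: (der_continuous dF).
move=> c; rewrite in_itv/= => /andP[c0 _] FE.
by rewrite -subr_ge0 FE subr0 mulr_ge0// f0.
Qed.

Lemma sin_le (y : R) : 0 <= y -> sin y <= y.
Proof.
move=> y0; rewrite -subr_ge0.
have -> : 0 = 0 - sin 0 :> R by rewrite sin0 subrr.
have d x : is_derive x (1 : R) (fun x => x - sin x) (1 - cos x).
  by notypeclasses refine (der_eq _ _); [der|ring].
apply: (le_of_derive_ge0 y0 d) => x _.
by rewrite subr_ge0 cos_le1.
Qed.

Lemma cos_ge1B (y : R) : 0 <= y -> 1 - y <= cos y.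
Proof.
move=> y0; suff : 0 <= cos y - 1 + y by lra.
have {1}-> : 0 = cos 0 - 1 + 0 :> R by rewrite cos0; ring.
have d x : is_derive x (1 : R) (fun x => cos x - 1 + x) (1 - sin x).
  by notypeclasses refine (der_eq _ _); [der|ring].
apply: (le_of_derive_ge0 y0 d) => x _.
by rewrite subr_ge0 sin_le1.
Qed.

Lemma cos_ge1Bsqr (y : R) : 0 <= y -> 1 - y ^+ 2 / 2 <= cos y.
Proof.
move=> y0; suff : 0 <= cos y - 1 + y ^+ 2 / 2 by lra.
have {1}-> : 0 = cos 0 - 1 + 0 ^+ 2 / 2 :> R by rewrite cos0; ring.
have d x : is_derive x (1 : R) (fun x => cos x - 1 + x ^+ 2 / 2) (x - sin x).
  by notypeclasses refine (der_eq _ _); [der|simpl; field].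
apply: (le_of_derive_ge0 y0 d) => x x0.
by rewrite subr_ge0 sin_le.
Qed.

Lemma sin_geBsqr (y : R) : 0 <= y -> y - y ^+ 2 / 2 <= sin y.
Proof.
move=> y0; suff : 0 <= sin y - y + y ^+ 2 / 2 by lra.
have {1}-> : 0 = sin 0 - 0 + 0 ^+ 2 / 2 :> R by rewrite sin0; ring.
have d x : is_derive x (1 : R) (fun x => sin x - x + x ^+ 2 / 2) (cos x - 1 + x).
  by notypeclasses refine (der_eq _ _); [der|simpl; field].
apply: (le_of_derive_ge0 y0 d) => x x0.
by have := cos_ge1B x0; lra.
Qed.

Lemma sin_geBcube (y : R) : 0 <= y -> y - y ^+ 3 / 6 <= sin y.
Proof.
move=> y0; suff : 0 <= sin y - y + y ^+ 3 / 6 by lra.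
have {1}-> : 0 = sin 0 - 0 + 0 ^+ 3 / 6 :> R by rewrite sin0; ring.
have d x : is_derive x (1 : R) (fun x => sin x - x + x ^+ 3 / 6) (cos x - 1 + x ^+ 2 / 2).
  by notypeclasses refine (der_eq _ _); [der|simpl; field].
apply: (le_of_derive_ge0 y0 d) => x x0.
by have := cos_ge1Bsqr x0; lra.
Qed.

Lemma cos_le_cube (y : R) : 0 <= y -> cos y <= 1 - y ^+ 2 / 2 + y ^+ 3 / 6.
Proof.
move=> y0; suff : 0 <= 1 - y ^+ 2 / 2 + y ^+ 3 / 6 - cos y by lra.
have {1}-> : 0 = 1 - 0 ^+ 2 / 2 + 0 ^+ 3 / 6 - cos 0 :> R by rewrite cos0; ring.
have d x : is_derive x (1 : R) (fun x => 1 - x ^+ 2 / 2 + x ^+ 3 / 6 - cos x)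
    (sin x - x + x ^+ 2 / 2).
  by notypeclasses refine (der_eq _ _); [der|simpl; field].
apply: (le_of_derive_ge0 y0 d) => x x0.
by have := sin_geBsqr x0; lra.
Qed.

Lemma norm_sinB_le (y : R) : `|sin y - y| <= `|y| ^+ 3.
Proof.
wlog y0 : y / 0 <= y => [H|].
  have [|y0] := leP 0 y; first exact: H.
  have := H (- y); rewrite sinN -opprD !normrN; apply.
  by rewrite oppr_ge0 ltW.
have := sin_le y0; have := sin_geBcube y0; have : 0 <= y ^+ 3 by rewrite exprn_ge0.
by rewrite (ger0_norm y0) ler_norml => *; apply/andP; split; lra.
Qed.

Lemma norm_cosB_le (y : R) : `|cos y - (1 - y ^+ 2 / 2)| <= `|y| ^+ 3.
Proof.
wlog y0 : y / 0 <= y => [H|].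
  have [|y0] := leP 0 y; first exact: H.
  have := H (- y); rewrite cosN sqrrN normrN; apply.
  by rewrite oppr_ge0 ltW.
have := cos_ge1Bsqr y0; have := cos_le_cube y0.
have : 0 <= y ^+ 3 by rewrite exprn_ge0.
by rewrite (ger0_norm y0) ler_norml => *; apply/andP; split; lra.
Qed.

(** The remainder is cubic in [y] uniformly in [x]: in the replacement argument [x] carries all the
    other frequencies. *)
Lemma cosD_taylor (x y : R) :
  `|cos (x + y) - (cos x * (1 - y ^+ 2 / 2) - sin x * y)| <= 2 * `|y| ^+ 3.
Proof.
rewrite cosD.
have -> : cos x * cos y - sin x * sin y - (cos x * (1 - y ^+ 2 / 2) - sin x * y) =
  cos x * (cos y - (1 - y ^+ 2 / 2)) - sin x * (sin y - y) by ring.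
rewrite (le_trans (ler_normB _ _))// !normrM.
have := norm_cosB_le y; have := norm_sinB_le y.
have := cos_max x; have := sin_max x.
move: `|cos x| `|sin x| (normr_ge0 (sin y - y)) (normr_ge0 (cos y - (1 - y ^+ 2 / 2))).
by move=> *; nra.
Qed.

Lemma norm_sin_le (y : R) : `|sin y| <= `|y|.
Proof.
wlog y0 : y / 0 <= y => [H|].
  have [|y0] := leP 0 y; first exact: H.
  have := H (- y); rewrite sinN !normrN; apply.
  by rewrite oppr_ge0 ltW.
rewrite (ger0_norm y0) ler_norml (sin_le y0) andbT.
have [y1|y1] := leP y 2; last by have := sin_geN1 y; lra.
by have := sin_geBsqr y0; nra.
Qed.

Lemma cos_lipschitz (x y : R) : `|cos x - cos y| <= `|x - y|.
Proof.
have [a [b [-> ->]]] : exists a b, x = a + b /\ y = a - b.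
  by exists ((x + y) / 2), ((x - y) / 2); split; field.
have -> : cos (a + b) - cos (a - b) = - 2 * (sin a * sin b) by rewrite cosD cosB; ring.
have -> : a + b - (a - b) = 2 * b by ring.
rewrite !normrM normrN [`|2|]ger0_norm// ler_pM2l//.
by rewrite -[leRHS]mul1r ler_pM// ?sin_max ?norm_sin_le.
Qed.

(** By [exp (- x) <= 1 / (1 + x) <= 1 - x + x^2]. It turns the factor [1 - x] of one replacement
    into an exponential at second-order cost. *)
Lemma expRN_le (x : R) : 0 <= x -> `|expR (- x) - (1 - x)| <= x ^+ 2.
Proof.
move=> x0; have h1 := expR_ge1Dx (- x); have h2 := expR_ge1Dx x.
rewrite ger0_norm; last lra.
have : expR (- x) <= (1 + x)^-1 by rewrite expRN lef_pV2 ?posrE ?expR_gt0//; lra.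
move=> /le_trans => /(_ (1 - x + x ^+ 2)) h3.
have {}/h3 : (1 + x)^-1 <= 1 - x + x ^+ 2; last by lra.
rewrite -[_^-1]mul1r ler_pdivrMr; last lra.
by rewrite -subr_ge0 (_ : _ - _ = x ^+ 3) ?exprn_ge0//; ring.
Qed.
End Taylor.

(** * Independence of frequencies *)

Section Independence.
Context {R : realType}.
Notation mu := (@lebesgue_measure R).
Implicit Types (f g : R -> R) (Om : set R).

Lemma Rintegral_cos_le (w a T : R) : w != 0 -> 0 < T ->
  `|\int[mu]_(t in `[0, T]) cos (w * t + a)| <= 2 / `|w|.
Proof.
move=> w0 T0; have d x : is_derive x (1 : R) (fun t => sin (w * t + a) / w)
    (cos (w * x + a)).
  by notypeclasses refine (der_eq _ _); [der|simpl; field].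
rewrite (Rintegral_FTC T0 (@continuous_cos_affine R w a) d).
rewrite -mulrBl normrM normfV ler_wpM2r ?invr_ge0//.
rewrite (le_trans (ler_normB _ _))//.
by have := sin_max (w * T + a); have := sin_max (w * 0 + a); lra.
Qed.

Lemma time_avg_cos0 (w a : R) : w != 0 -> time_avg_is (fun t => cos (w * t + a)) 0.
Proof.
move=> w0; apply/time_avgP => e e0; near=> T.
have T0 : 0 < T by near: T; exact: nbhs_pinfty_gt.
have w1 : 0 < `|w| by rewrite normr_gt0.
have Te : 2 / `|w| / e <= T by near: T; apply: nbhs_pinfty_ge; exact: num_real.
rewrite sub0r normrN /avg normrM gtr0_norm ?invr_gt0//.
rewrite mulrC ler_pdivrMr// (le_trans (Rintegral_cos_le a w0 T0))//.
by move: Te; rewrite ler_pdivrMr// (mulrC T).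
Unshelve. all: by end_near. Qed.

Lemma time_avg_cos (w a : R) : exists b, time_avg_is (fun t => cos (w * t + a)) b.
Proof.
have [->|w0] := eqVneq w 0; last by exists 0; exact: time_avg_cos0.
exists (cos a); under eq_fun do rewrite mul0r add0r; exact: time_avg_cst.
Qed.

Lemma lint_trigsum (s : seq (R * R * R)) : lint (trigsum s).
Proof. by apply: lint_continuous; exact: continuous_trigsum. Qed.

Lemma lint_ap Om f : ap Om f -> lint f.
Proof. by move=> /ap_continuous; exact: lint_continuous. Qed.

Lemma time_avg_trigsum (s : seq (R * R * R)) : exists b, time_avg_is (trigsum s) b.
Proof.
have H (z : R * R * R) : {b | time_avg_is (fun t => z.1.1 * cos (z.1.2 * t + z.2)) b}.
  apply: cid; have [b hb] := time_avg_cos z.1.2 z.2; exists (z.1.1 * b).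
  by apply: time_avgZ => //; apply: lint_continuous; exact: continuous_cos_affine.
exists (\sum_(z <- s) sval (H z)); apply: time_avg_sum => z; last exact: svalP.
by apply: lintZ; apply: lint_continuous; exact: continuous_cos_affine.
Qed.

Lemma time_avg_trigsum0 (s : seq (R * R * R)) : (forall z, z \in s -> z.1.2 != 0) ->
  time_avg_is (trigsum s) 0.
Proof.
elim: s => [|z s IH] H.
  rewrite (_ : trigsum [::] = fun=> 0); first exact: time_avg_cst.
  by apply/funext => t; rewrite /trigsum big_nil.
rewrite (_ : trigsum (z :: s) = fun t => z.1.1 * cos (z.1.2 * t + z.2) + trigsum s t);
    last by apply/funext => t; rewrite /trigsum big_cons.
rewrite -[0](addr0 0) -{1}(mulr0 z.1.1).
have lc : lint (fun t => cos (z.1.2 * t + z.2)).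
  by apply: lint_continuous; exact: continuous_cos_affine.
apply: time_avgD; [exact: lintZ|exact: lint_trigsum| |].
  by apply: time_avgZ => //; apply/time_avg_cos0/H; rewrite mem_head.
by apply: IH => y ys; apply: H; rewrite inE ys orbT.
Qed.

Lemma ap_um Om f e : ap Om f -> 0 < e -> exists2 s : seq (R * R * R),
  (forall z, z \in s -> Om z.1.2) & um (fun t => f t - trigsum s t) e.
Proof.
move=> apf e0; have [s sOm fs] := apf e e0; exists s => //.
by apply: um_bounded => //; apply: lintB; [exact: (lint_ap apf)|exact: lint_trigsum].
Qed.

Lemma ap_time_avg Om f : ap Om f -> exists a, time_avg_is f a.
Proof.
move=> apf; apply: time_avg_exists; first exact: (lint_ap apf).
move=> e e0; have [s _ us] := ap_um apf e0.
by exists (trigsum s); split=> //; [exact: lint_trigsum|exact: time_avg_trigsum].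
Qed.

(** The approximating sums have no zero frequency, so each has mean [0]. It is applied with [Om] a
    translate of a frequency group. *)
Lemma ap_time_avg0 Om f : ap Om f -> ~ Om 0 -> time_avg_is f 0.
Proof.
move=> apf Om0; have [a fa] := ap_time_avg apf.
suff -> : 0 = a by [].
apply/esym/eqP; rewrite -normr_le0; apply/ler_addgt0Pr => e e0; rewrite add0r.
have [s sOm us] := ap_um apf e0; rewrite -(subr0 a).
apply: time_avg_close (lint_ap apf) (lint_trigsum s) fa _ us.
apply: time_avg_trigsum0 => z /sOm Omz; apply: contra_notN Om0 => /eqP <-//.
Qed.

(** Infinite order of [v] modulo [Om]: no harmonic of [v] resonates with a frequency of [Om]. *)
Definition indep_freq Om (v : R) := forall z : int, z != 0 -> ~ Om (z%:~R * v).

Lemma time_avg_ap_cos Om f (v : R) (z : int) : is_subgroup Om -> indep_freq Om v ->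
  ap Om f -> z != 0 -> time_avg_is (fun t => cos (z%:~R * (v * t)) * f t) 0.
Proof.
move=> OmG Omv apf z0.
(* The coset of [z v] modulo [Om], with both signs as product-to-sum produces them; independence of
   [v] says that it misses [0]. *)
pose Om' : set R := [set w | exists2 u, Om u & w = z%:~R * v + u \/ w = z%:~R * v - u].
have apg : ap Om' (fun t => 1 * cos (z%:~R * v * t + 0) * f t).
  apply: (ap_Mcos (Om := Om)) => // w Omw.
  by split; exists w; auto.
have {apg} := ap_time_avg0 apg.
under [in X in X -> _]eq_fun do rewrite mul1r addr0 -mulrA.
apply=> -[u Omu [/esym/eqP|/esym/eqP]].
- rewrite addr_eq0 => /eqP zv; apply: (Omv z z0); rewrite zv -sub0r.
  by apply: (OmG.2) => //; exact: (OmG.1).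
- by rewrite subr_eq0 => /eqP zv; apply: (Omv z z0); rewrite zv.
Qed.

(** Harmonic [k + 1] carries [d k]: there is no constant term, so the mean over a period is [0]. *)
Definition cospoly (d : nat -> R) (N : nat) (x : R) : R :=
  \sum_(k < N) d k * cos (k.+1%:R * x).

(** Mean square of [cospoly d N] over a period, each [cos^2] having mean [1 / 2]. *)
Definition cosvar (d : nat -> R) (N : nat) : R := 2^-1 * \sum_(k < N) (d k) ^+ 2.

Lemma continuous_cospoly d N (v : R) : continuous (fun t => cospoly d N (v * t)).
Proof.
rewrite /cospoly; elim: N => [|N IH] t.
  by under eq_fun do rewrite big_ord0; exact: cvg_cst.
under eq_fun do rewrite big_ord_recr/=.
apply: cvgD; first exact: IH.
apply: cvgM; first exact: cvg_cst.
under eq_fun do rewrite mulrA -[X in cos X]addr0.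
rewrite mulrA -[X in cos X]addr0; exact: continuous_cos_affine.
Qed.

(** Independence in use: the joint mean factors, and the factor of [cospoly] is [0]. *)
Lemma time_avg_ap_cospoly Om f (v : R) d N : is_subgroup Om -> indep_freq Om v ->
  ap Om f -> time_avg_is (fun t => cospoly d N (v * t) * f t) 0.
Proof.
move=> OmG Omv apf.
have -> : (fun t => cospoly d N (v * t) * f t) =
    (fun t => \sum_(k < N) d k * (cos (k.+1%:R * (v * t)) * f t)).
  by apply/funext => t; rewrite /cospoly mulr_suml; apply: eq_bigr => k _; rewrite -mulrA.
have lk (k : 'I_N) : lint (fun t => cos (k.+1%:R * (v * t)) * f t).
  apply: lint_continuous => t; apply: cvgM; last exact: (ap_continuous apf).
  under eq_fun do rewrite mulrA -[X in cos X]addr0.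
  rewrite mulrA -[X in cos X]addr0; exact: continuous_cos_affine.
suff : time_avg_is (fun t => \sum_(k < N) d k * (cos (k.+1%:R * (v * t)) * f t))
    (\sum_(k < N) d k * 0) by rewrite big1// => k _; rewrite mulr0.
apply: time_avg_sum => k; first exact: lintZ.
by apply: time_avgZ => //; exact: (@time_avg_ap_cos Om f v k.+1%:Z).
Qed.

(** Squaring produces the harmonics [k + l + 2] and [k - l] of [v]; only [k = l] in the second gives
    a zero frequency and survives averaging. *)
Lemma time_avg_ap_cospoly_sqr Om f (v : R) d N m : is_subgroup Om -> indep_freq Om v ->
  ap Om f -> time_avg_is f m ->
  time_avg_is (fun t => cospoly d N (v * t) ^+ 2 * f t) (cosvar d N * m).
Proof.
move=> OmG Omv apf fm.
have lz (z : int) : lint (fun t => cos (z%:~R * (v * t)) * f t).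
  apply: lint_continuous => t; apply: cvgM; last exact: (ap_continuous apf).
  under eq_fun do rewrite mulrA -[X in cos X]addr0.
  rewrite mulrA -[X in cos X]addr0; exact: continuous_cos_affine.
pose g (k l : 'I_N) t := d k * d l / 2 * (cos ((k + l).+2%:Z%:~R * (v * t)) * f t +
  cos ((k%:Z - l%:Z)%:~R * (v * t)) * f t).
have -> : (fun t => cospoly d N (v * t) ^+ 2 * f t) =
    (fun t => \sum_(k < N) \sum_(l < N) g k l t).
  apply/funext => t; rewrite expr2 /cospoly mulr_suml mulr_suml.
  apply: eq_bigr => k _; rewrite mulr_sumr mulr_suml; apply: eq_bigr => l _.
  rewrite /g -mulrDl.
  have -> : (k + l).+2%:Z%:~R * (v * t) = k.+1%:R * (v * t) + l.+1%:R * (v * t).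
    by rewrite -mulrDl -natrD addSn addnS.
  have -> : (k%:Z - l%:Z)%:~R * (v * t) = k.+1%:R * (v * t) - l.+1%:R * (v * t).
    by rewrite -mulrBl rmorphB/= -!natr1 opprD addrACA subrr addr0.
  transitivity (d k * d l * (cos (k.+1%:R * (v * t)) * cos (l.+1%:R * (v * t))) * f t).
    by ring.
  by rewrite cosM; field.
have -> : cosvar d N * m =
    \sum_(k < N) \sum_(l < N) d k * d l / 2 * (0 + (if k == l then m else 0)).
  rewrite /cosvar mulrAC mulr_sumr; apply: eq_bigr => k _.
  rewrite (bigD1 k)//= eqxx big1 => [|l /negbTE lk]; first by rewrite add0r; field.
  by rewrite eq_sym lk addr0 mulr0.
have lg k l : lint (g k l) by apply: lintZ; apply: lintD; exact: lz.
apply: time_avg_sum => k; first by apply: lint_sum => l; exact: lg.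
apply: time_avg_sum => l //.
apply: time_avgZ; first by apply: lintD; exact: lz.
apply: time_avgD; [exact: lz|exact: lz|exact: (@time_avg_ap_cos Om f)|].
have [->|kl] := eqVneq k l.
  by under eq_fun do rewrite subrr mul0r cos0 mul1r.
apply: (@time_avg_ap_cos Om f) => //.
by rewrite subr_eq0; apply: contra_neq kl => /eqP; rewrite eqz_nat => /eqP /val_inj.
Qed.

End Independence.

(** * Sums over independent frequencies and Lindeberg replacement *)

Section Lindeberg.
Context {R : realType}.
Implicit Types (s : seq R) (c : R -> R) (d : nat -> R).

Lemma continuous_fsqr (f : R -> R) : continuous f -> continuous (fun t => f t ^+ 2).
Proof.
move=> cf t; apply: (@continuous_comp _ _ _ f (fun x => x ^+ 2)); first exact: cf.
exact: exprn_continuous.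
Qed.

Fixpoint zspan s : set R :=
  if s is v :: s' then [set w | exists z : int, zspan s' (w - z%:~R * v)]
  else [set 0].

(** Each frequency is independent of the group generated by the later ones, the form in which
    inductions peel off the head of the list. *)
Fixpoint zindep s : Prop :=
  if s is v :: s' then indep_freq (zspan s') v /\ zindep s' else True.

Lemma zspan_subgroup s : is_subgroup (zspan s).
Proof.
elim: s => [|v s [IH0 IHB]]; split=> //=.
- by move=> x y -> ->; rewrite subrr.
- by exists 0; rewrite mul0r subrr.
- move=> x y [z hz] [z' hz']; exists (z - z').
  rewrite (_ : _ - _ = (x - z%:~R * v) - (y - z'%:~R * v)); last first.
    by rewrite rmorphB/=; ring.
  exact: IHB.
Qed.

Lemma ap_zspan_cons s v f : ap (zspan s) f -> ap (zspan (v :: s)) f.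
Proof.
move=> apf e e0; have [r rs fr] := apf e e0; exists r => // z zr /=.
by exists 0; rewrite mul0r subr0; exact: rs.
Qed.

Definition linsum (h : R -> R) c s (t : R) : R := \sum_(v <- s) c v * h (v * t).

Lemma linsum_cons h c v s t :
  linsum h c (v :: s) t = c v * h (v * t) + linsum h c s t.
Proof. by rewrite /linsum big_cons. Qed.

Lemma ap_cospoly d N s v : ap (zspan (v :: s)) (fun t => cospoly d N (v * t)).
Proof.
have G := zspan_subgroup (v :: s).
rewrite /cospoly; elim: N => [|N IH].
  by apply: ap_ext (ap_cst 0 G) => t; rewrite big_ord0.
apply: (ap_ext (f := (fun t => \sum_(k < N) d k * cos (k.+1%:R * (v * t))) \+
                     (fun t => d N * cos (N.+1%:R * v * t + 0)))).
  by move=> t /=; rewrite big_ord_recr/= addr0 mulrA.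
apply: apD => //; apply: apZ; apply: ap_cos.
by exists N.+1%:Z; rewrite subrr; exact: (zspan_subgroup s).1.
Qed.

Lemma ap_linsum d N c s : ap (zspan s) (linsum (cospoly d N) c s).
Proof.
elim: s => [|v s IH].
  apply: ap_ext (ap_cst 0 (zspan_subgroup [::])) => t.
  by rewrite /linsum big_nil.
apply: (ap_ext (f := (fun t => c v * cospoly d N (v * t)) \+ linsum (cospoly d N) c s)).
  by move=> t; rewrite linsum_cons.
by apply: apD; [apply: apZ; exact: ap_cospoly|exact: ap_zspan_cons].
Qed.

(** Pythagoras: head and tail are orthogonal, their product having mean [0]. *)
Lemma time_avg_linsum_sqr d N c s : zindep s ->
  time_avg_is (fun t => linsum (cospoly d N) c s t ^+ 2)
    (cosvar d N * \sum_(v <- s) c v ^+ 2).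
Proof.
elim: s => [_|v s IH /= [indv inds]].
  rewrite big_nil mulr0 (_ : (fun t => _) = fun=> 0); first exact: time_avg_cst.
  by apply/funext => t; rewrite /linsum big_nil expr0n.
have G := zspan_subgroup s.
set P := fun t => cospoly d N (v * t).
set F := linsum (cospoly d N) c s.
have cP : continuous P by exact: continuous_cospoly.
have apF : ap (zspan s) F by exact: ap_linsum.
have cF : continuous F := ap_continuous apF.
have -> : (fun t => linsum (cospoly d N) c (v :: s) t ^+ 2) =
    (fun t => c v ^+ 2 * (P t ^+ 2 * 1) + (2 * c v * (P t * F t) + F t ^+ 2)).
  by apply/funext => t; rewrite linsum_cons -/(P t) -/(F t); ring.
rewrite big_cons mulrDr.
have h1 := @time_avg_ap_cospoly_sqr R _ _ v d N _ G indv (ap_cst 1 G) (@time_avg_cst R 1).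
have h2 := @time_avg_ap_cospoly R _ _ v d N G indv apF.
have -> : cosvar d N * c v ^+ 2 = c v ^+ 2 * (cosvar d N * 1) by ring.
have l1 : lint (fun t => P t ^+ 2 * 1).
  apply: lint_continuous => t; apply: cvgM; last exact: cvg_cst.
  exact: continuous_fsqr.
have l2 : lint (fun t => P t * F t).
  by apply: lint_continuous => t; apply: cvgM; [exact: cP|exact: cF].
have l3 : lint (fun t => F t ^+ 2).
  by apply: lint_continuous; exact: continuous_fsqr.
apply: time_avgD; [exact: lintZ|by apply: lintD => //; exact: lintZ| |].
  exact: time_avgZ.
rewrite -[cosvar d N * _]add0r -[X in X + _](mulr0 (2 * c v)).
by apply: time_avgD => //; [exact: lintZ|exact: time_avgZ|exact: IH].
Qed.

Lemma cospoly_le d N x : `|cospoly d N x| <= \sum_(k < N) `|d k|.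
Proof.
rewrite (le_trans (ler_norm_sum _ _ _))// ler_sum// => k _.
by rewrite normrM ler_piMr// cos_max.
Qed.

(* Taylor expansion in the summand of the first frequency, which is independent of
   the others, multiplies the mean by [1 - xi^2 V c^2 / 2] up to [O(c^3)]. *)
Lemma lindeberg d N (xi al : R) : exists2 K, 0 <= K & forall c s, zindep s ->
  (forall v, v \in s -> `|c v| <= 1) ->
  exists2 m, time_avg_is (fun t => cos (xi * linsum (cospoly d N) c s t + al)) m &
    `|m - expR (- (xi ^+ 2 * cosvar d N / 2 * \sum_(v <- s) c v ^+ 2)) * cos al|
      <= K * \sum_(v <- s) `|c v| ^+ 3.
Proof.
set V := cosvar d N.
have V0 : 0 <= V by rewrite /V mulr_ge0// sumr_ge0// => k _; exact: sqr_ge0.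
set B := \sum_(k < N) `|d k|; have B0 : 0 <= B by rewrite sumr_ge0.
(* The first summand is the cubic Taylor remainder, with [B] bounding the polynomial; the second
   pays for replacing [1 - x] by [exp (- x)]. Neither involves [c] or [s]. *)
pose K := 2 * (`|xi| * B) ^+ 3 + xi ^+ 4 * V ^+ 2.
have xi4 : 0 <= xi ^+ 4 by rewrite (exprM xi 2 2) sqr_ge0.
have K0 : 0 <= K.
  by rewrite addr_ge0// mulr_ge0// ?sqr_ge0// exprn_ge0// mulr_ge0.
exists K => // c; elim=> [_ _|v s IH /= [indv inds] cs].
  exists (cos al); last by rewrite !big_nil !mulr0 oppr0 expR0 mul1r subrr normr0.
  rewrite (_ : (fun t => _) = fun=> cos al); first exact: time_avg_cst.
  by apply/funext => t; rewrite /linsum big_nil mulr0 add0r.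
have cv1 : `|c v| <= 1 by apply: cs; rewrite mem_head.
have [|m' hm' m'E] := IH inds; first by move=> y ys; apply: cs; rewrite inE ys orbT.
have G := zspan_subgroup s.
set P := fun t => cospoly d N (v * t).
set F := linsum (cospoly d N) c s.
have cP : continuous P by exact: continuous_cospoly.
have apF : ap (zspan s) F by exact: ap_linsum.
have ap1 : ap (zspan s) (fun t => cos (xi * F t + al)).
  exact: (@ap_comp R (zspan s) F (fun y => cos (xi * y + al)) G
    (@continuous_cos_affine R xi al) apF).
have csin : continuous (fun y : R => sin (xi * y + al)).
  under eq_fun do rewrite -cosBpihalf -addrA; exact: continuous_cos_affine.
have ap2 : ap (zspan s) (fun t => sin (xi * F t + al)).
  exact: (@ap_comp R (zspan s) F (fun y => sin (xi * y + al)) G csin apF).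
have ap3 : ap (zspan (v :: s)) (fun t => cos (xi * linsum (cospoly d N) c (v :: s) t + al)).
  exact: (@ap_comp R _ _ (fun y => cos (xi * y + al)) (zspan_subgroup (v :: s))
    (@continuous_cos_affine R xi al) (@ap_linsum d N c (v :: s))).
have [m hm] := ap_time_avg ap3; exists m => //.
set f1 := fun t => cos (xi * F t + al) in ap1 hm' *.
set f2 := fun t => sin (xi * F t + al) in ap2 *.
have h1 := @time_avg_ap_cospoly_sqr R _ _ v d N _ G indv ap1 hm'.
have h2 := @time_avg_ap_cospoly R _ _ v d N G indv ap2.
rewrite -/V -/P in h1 h2.
have cf1 := ap_continuous ap1; have cf2 := ap_continuous ap2.
have l0 : lint f1 by exact: (lint_ap ap1).
have l1 : lint (fun t => P t ^+ 2 * f1 t).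
  apply: lint_continuous => t; apply: cvgM; last exact: cf1.
  exact: continuous_fsqr.
have l2 : lint (fun t => P t * f2 t).
  by apply: lint_continuous => t; apply: cvgM; [exact: cP|exact: cf2].
set x := xi ^+ 2 * V / 2 * c v ^+ 2.
have x0 : 0 <= x by rewrite /x mulr_ge0 ?sqr_ge0// divr_ge0// mulr_ge0 ?sqr_ge0.
(* Second-order expansion in the head summand: [P^2 f1] has mean [V m'] and [P f2] has mean [0],
   whence the mean [(1 - x) m']. *)
set g := fun t => f1 t + (- (xi ^+ 2 * c v ^+ 2 / 2) * (P t ^+ 2 * f1 t)
  + - (xi * c v) * (P t * f2 t)).
have lg : lint g by apply: lintD => //; apply: lintD; exact: lintZ.
have hg : time_avg_is g ((1 - x) * m').
  have -> : (1 - x) * m' = m' + (- (xi ^+ 2 * c v ^+ 2 / 2) * (V * m') +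
    - (xi * c v) * 0) by rewrite /x; field.
  apply: time_avgD => //; first by apply: lintD; exact: lintZ.
  by apply: time_avgD; [exact: lintZ|exact: lintZ|exact: time_avgZ|exact: time_avgZ].
have c30 : 0 <= `|c v| ^+ 3 by rewrite exprn_ge0.
have m1 : `|m - (1 - x) * m'| <= 2 * (`|xi| * B) ^+ 3 * `|c v| ^+ 3.
  apply: (time_avg_close (lint_ap ap3) lg hm hg).
  apply: um_bounded => [|t]; first by apply: lintB; [exact: (lint_ap ap3)|exact: lg].
  rewrite linsum_cons -/(P t) -/(F t).
  have -> : xi * (c v * P t + F t) + al = (xi * F t + al) + xi * c v * P t by ring.
  have -> : g t = cos (xi * F t + al) * (1 - (xi * c v * P t) ^+ 2 / 2) -
    sin (xi * F t + al) * (xi * c v * P t) by rewrite /g /f1 /f2; field.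
  rewrite (le_trans (cosD_taylor _ _))// -[leRHS]mulrA ler_pM2l// -exprMn.
  rewrite lerXn2r ?nnegrE ?mulr_ge0// !normrM.
  rewrite (_ : _ * B * _ = `|xi| * `|c v| * B); last by ring.
  by rewrite ler_wpM2l ?mulr_ge0// cospoly_le.
have m'1 : `|m'| <= 1.
  apply: (time_avg_le_um l0 hm'); apply: um_bounded => // t; exact: cos_max.
rewrite !big_cons -/V.
set S2 := \sum_(j <- s) c j ^+ 2 in m'E *; set S3 := \sum_(j <- s) `|c j| ^+ 3 in m'E *.
set E' := expR (- (xi ^+ 2 * V / 2 * S2)) in m'E.
rewrite mulrDr opprD expRD -/x -/E' -mulrA.
set ex := expR (- x).
have ex1 : ex <= 1 by rewrite /ex -expR0 ler_expR oppr_le0.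
have ex0 : 0 <= ex by exact: expR_ge0.
have hex : `|ex - (1 - x)| <= x ^+ 2 := expRN_le x0.
(* Here [|c v| <= 1] turns the fourth power coming from [x^2] into a third power. *)
have x2 : x ^+ 2 <= xi ^+ 4 * V ^+ 2 * `|c v| ^+ 3.
  have -> : x ^+ 2 = xi ^+ 4 * V ^+ 2 * (c v ^+ 4 / 4) by rewrite /x; field.
  rewrite ler_wpM2l//; first by rewrite mulr_ge0// sqr_ge0.
  have -> : c v ^+ 4 = `|c v| ^+ 3 * `|c v|.
    by rewrite -exprSr -(normrX 4) ger0_norm// (exprM _ 2 2) sqr_ge0.
  by nra.
have -> : m - ex * (E' * cos al) = (m - (1 - x) * m') - (ex - (1 - x)) * m' +
    ex * (m' - E' * cos al) by ring.
rewrite (le_trans (ler_normD _ _))// [leRHS]mulrDr lerD//.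
  rewrite (le_trans (ler_normB _ _))// /K [leRHS]mulrDl lerD// normrM.
  by rewrite (le_trans _ x2)// (le_trans _ hex)// ler_piMr.
by rewrite normrM (ger0_norm ex0) (le_trans _ m'E)// ler_piMl.
Qed.

End Lindeberg.

(** * The logarithmic potential *)

Section LogSeries.
Context {R : realType}.
Notation mu := (@lebesgue_measure R).

(** This is [ln |1 + r e^(i x)|^2], smooth in [x] for [0 <= r < 1]. *)
Definition logker (r x : R) : R := ln (1 + 2 * r * cos x + r ^+ 2).

(** Power series of twice the real part of [ln (1 + r e^(i x))]: entry [k] belongs to the harmonic
    [k + 1]. *)
Definition logcoef (r : R) (k : nat) : R := 2 * (-1) ^+ k * r ^+ k.+1 / k.+1%:R.

Lemma logker_arg_ge (r x : R) : 0 <= r -> (1 - r) ^+ 2 <= 1 + 2 * r * cos x + r ^+ 2.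
Proof. by move=> r0; have := cos_geN1 x; nra. Qed.

Lemma logker_arg_gt0 (r x : R) : 0 <= r < 1 -> 0 < 1 + 2 * r * cos x + r ^+ 2.
Proof.
move=> /andP[r0 r1]; apply: lt_le_trans (logker_arg_ge x r0).
by rewrite exprn_gt0// subr_gt0.
Qed.

(* Real part of the geometric sum of [e^(i x) (- r e^(i x))^k], multiplied out. *)
Lemma cos_geometric (r x : R) N :
  (1 + 2 * r * cos x + r ^+ 2) * \sum_(k < N) (-1) ^+ k * r ^+ k * cos (k.+1%:R * x) =
  cos x + r - (-1) ^+ N * r ^+ N * (cos (N.+1%:R * x) + r * cos (N%:R * x)).
Proof.
elim: N => [|N IH].
  by rewrite big_ord0 !expr0 mul0r cos0 !mul1r; ring.
rewrite big_ord_recr/= mulrDr IH.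
have rec : cos (N.+2%:R * x) = 2 * cos x * cos (N.+1%:R * x) - cos (N%:R * x).
  have -> : N.+2%:R * x = N.+1%:R * x + x by rewrite -[in LHS]natr1 mulrDl mul1r.
  have -> : N%:R * x = N.+1%:R * x - x by rewrite -[in RHS]natr1 mulrDl mul1r addrK.
  by rewrite cosD cosB; ring.
by rewrite rec !exprS; ring.
Qed.

Lemma der_ln (x : R) (f : R -> R) (a : R) : 0 < f x -> is_derive x (1 : R) f a ->
  is_derive x (1 : R) (fun y => ln (f y)) (a / f x).
Proof. by move=> fx0 df; exact: (der_comp (is_derive1_ln fx0) df). Qed.

Lemma der_sum (x : R) (f : nat -> R -> R) (a : nat -> R) N :
  (forall k, is_derive x (1 : R) (f k) (a k)) ->
  is_derive x (1 : R) (fun y => \sum_(k < N) f k y) (\sum_(k < N) a k).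
Proof.
move=> df; elim: N => [|N IH].
  by rewrite big_ord0; under eq_fun do rewrite big_ord0; exact: der_cst.
by rewrite big_ord_recr/=; under eq_fun do rewrite big_ord_recr/=; exact: der_D.
Qed.

(** Mean value theorem in [r] at fixed [x]: the difference vanishes at [r = 0], and its derivative
    in [r] is exactly the remainder of the finite geometric sum. *)
Lemma logker_series (r x : R) N : 0 <= r < 1 ->
  `|logker r x - cospoly (logcoef r) N x| <= 4 * r ^+ N / (1 - r) ^+ 2.
Proof.
move=> /andP[r0 r1].
pose G (p : R) := logker p x - cospoly (logcoef p) N x.
pose q (p : R) := 1 + 2 * p * cos x + p ^+ 2.
pose G' (p : R) := 2 * ((-1) ^+ N * p ^+ N *
   (cos (N.+1%:R * x) + p * cos (N%:R * x))) / q p.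
have dG (p : R) : 0 <= p < 1 -> is_derive p (1 : R) G (G' p).
  move=> p01; have q0 : 0 < q p := logker_arg_gt0 x p01.
  have dk k : is_derive p (1 : R) (fun y => logcoef y k * cos (k.+1%:R * x))
      (2 * ((-1) ^+ k * p ^+ k * cos (k.+1%:R * x))).
    rewrite /logcoef; notypeclasses refine (der_eq _ _); [der|simpl].
    set C := cos _; have := pnatr_eq0 R k.+1; set w := k.+1%:R => w0; field.
    by rewrite ?w0.
  have dln : is_derive p (1 : R) (fun y => logker y x) ((2 * cos x + 2 * p) / q p).
    rewrite /logker; apply: (der_ln (f := q)) => //.
    by notypeclasses refine (der_eq _ _); [der|simpl; ring].
  notypeclasses refine (der_eq (der_D dln (der_N (der_sum N dk))) _).
  rewrite -mulr_sumr; apply: (mulIf (lt0r_neq0 q0)).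
  rewrite /G' divfK ?lt0r_neq0// mulrBl divfK ?lt0r_neq0// mulrAC -mulrA -/(q p).
  by rewrite cos_geometric; ring.
have G0 : G 0 = 0.
  rewrite /G /logker /cospoly mulr0 mul0r expr0n/= !addr0 ln1 big1 ?subrr// => k _.
  by rewrite /logcoef expr0n/= mulr0 !mul0r.
have dGi (p : R) : p \in `]0, r[ -> is_derive p (1 : R) G (G' p).
  by rewrite in_itv/= => /andP[p0 pr]; apply: dG; rewrite (ltW p0) (lt_trans pr).
have cG : {within `[0, r], continuous G}.
  apply: derivable_within_continuous => p; rewrite in_itv/= => /andP[p0 pr].
  have p01 : 0 <= p < 1 by rewrite p0 (le_lt_trans pr).
  by have := dG p p01; case.
have [p] := @MVT_segment R G G' 0 r r0 dGi cG.
rewrite in_itv/= G0 !subr0 => /andP[p0 pr] GE.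
rewrite -/(G r) GE /G'.
have p1 : p < 1 := le_lt_trans pr r1.
have p01 : 0 <= p < 1 by rewrite p0.
have q0 : 0 < q p := logker_arg_gt0 x p01.
have b0 : 0 < (1 - r) ^+ 2 by rewrite exprn_gt0// subr_gt0.
rewrite normrM (ger0_norm r0) (le_trans (ler_piMr _ (ltW r1)))//.
rewrite normrM normfV (gtr0_norm q0) ler_pM ?invr_ge0 ?(ltW q0)//; last first.
  rewrite lef_pV2// (le_trans _ (logker_arg_ge x p0))//.
  by rewrite lerXn2r ?nnegrE ?subr_ge0 ?(ltW p1) ?(ltW r1)// lerD2l lerN2.
rewrite normrM (ger0_norm (ler0n R 2)).
have -> : 4 * r ^+ N = 2 * (r ^+ N * 2) by ring.
rewrite ler_pM2l// !normrM normrX normrN1 expr1n mul1r.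
apply: ler_pM => //; first by rewrite normrX (ger0_norm p0) lerXn2r.
rewrite (le_trans (ler_normD _ _))// normrM (ger0_norm p0).
have := cos_max (N.+1%:R * x); have := cos_max (N%:R * x).
by move: `|cos (N%:R * x)| => u *; nra.
Qed.

Lemma sum_invsqr_le N : \sum_(k < N) (k.+1%:R ^+ 2)^-1 <= 2 :> R.
Proof.
suff H n : \sum_(k < n.+1) (k.+1%:R ^+ 2)^-1 <= 2 - n.+1%:R^-1 :> R.
  case: N => [|n]; first by rewrite big_ord0.
  by rewrite (le_trans (H n))// lerBlDr lerDl.
elim: n => [|n IH]; first by rewrite big_ord_recr big_ord0/= expr1n add0r invr1; lra.
rewrite big_ord_recr/= (le_trans (lerD IH (lexx _)))// -addrA lerD2l.
rewrite -subr_ge0.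
have -> : - n.+2%:R^-1 - (- n.+1%:R^-1 + (n.+2%:R ^+ 2)^-1) =
    (n.+1%:R * n.+2%:R ^+ 2)^-1 :> R.
  rewrite -[n.+2%:R]natr1.
  have := ltr0n R n.+1; move: (n.+1%:R : R) => w /= w0.
  by field; rewrite !gt_eqF// addr_gt0.
by rewrite invr_ge0 mulr_ge0// exprn_ge0.
Qed.

Lemma lint_logker (r v : R) : 0 <= r < 1 -> lint (fun t => logker r (v * t)).
Proof.
move=> r01; apply: lint_continuous.
have d (t : R) : is_derive t (1 : R) (fun t => logker r (v * t))
    (((2 * r) * (- v * sin (v * t))) / (1 + 2 * r * cos (v * t) + r ^+ 2)).
  apply: (der_ln (f := fun t => 1 + 2 * r * cos (v * t) + r ^+ 2)).
    exact: logker_arg_gt0.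
  by notypeclasses refine (der_eq _ _); [der|simpl; ring].
exact: (der_continuous d).
Qed.

Lemma lint_cospoly d N (v : R) : lint (fun t => cospoly d N (v * t)).
Proof. by apply: lint_continuous; exact: continuous_cospoly. Qed.

Lemma Rintegral_sum_cos_le d N (v T : R) : v != 0 -> 0 < T ->
  `|\int[mu]_(t in `[0, T]) cospoly d N (v * t)| <=
    \sum_(k < N) `|d k| * (2 / (k.+1%:R * `|v|)).
Proof.
move=> v0 T0; elim: N => [|N IH].
  rewrite big_ord0 (_ : (fun t => _) = fun=> 0).
    by rewrite Rintegral_cst// mul0r normr0.
  by apply/funext => t; rewrite /cospoly big_ord0.
have lc : lint (fun t => cos (N.+1%:R * v * t + 0)).
  by apply: lint_continuous; exact: continuous_cos_affine.
rewrite (_ : (fun t => _) = fun t => cospoly d N (v * t) +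
    d N * cos (N.+1%:R * v * t + 0)); last first.
  by apply/funext => t; rewrite /cospoly big_ord_recr/= addr0 mulrA.
rewrite RintegralD//; [|exact: lint_cospoly|exact: (lintZ (d N) lc T)].
rewrite big_ord_recr/= (le_trans (ler_normD _ _))// lerD//.
rewrite RintegralZl//.
rewrite normrM ler_wpM2l// (le_trans (Rintegral_cos_le _ _ _))//.
  by rewrite mulf_neq0// pnatr_eq0.
by rewrite normrM normr_nat.
Qed.

(** Integrating a harmonic gains a factor [1 / (k + 1)] on top of the one in [logcoef], and
    [4 / |v|] times the sum of inverse squares is at most [8 / |v|]. The bound is free of [r] and
    [T], so it survives Fatou as [r -> 1] and becomes negligible after division by [T]. *)
Lemma Rintegral_logker_le (r v T : R) : 0 <= r < 1 -> v != 0 -> 0 < T ->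
  `|\int[mu]_(t in `[0, T]) logker r (v * t)| <= 8 / `|v|.
Proof.
move=> r01 v0 T0; have /andP[r0 r1] := r01; apply/ler_addgt0Pr => e e0.
have b0 : 0 < (1 - r) ^+ 2 by rewrite exprn_gt0// subr_gt0.
have [N hN] : exists N, 4 * r ^+ N / (1 - r) ^+ 2 * T <= e.
  have : (fun N => 4 * r ^+ N / (1 - r) ^+ 2 * T) @ \oo --> (4 * 0 / (1 - r) ^+ 2 * T).
    apply: cvgM; last exact: cvg_cst.
    apply: cvgM; last exact: cvg_cst.
    by apply: cvgM; [exact: cvg_cst|apply: cvg_expr; rewrite ger0_norm].
  rewrite mulr0 !mul0r => /cvgrPdist_le/(_ e e0)[N _ /(_ N (leqnn N))] h.
  exists N; apply: le_trans h; rewrite sub0r normrN; exact: ler_norm.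
pose P t := cospoly (logcoef r) N (v * t).
have lP : lint P by exact: lint_cospoly.
have lL := lint_logker v r01.
have -> : \int[mu]_(t in `[0, T]) logker r (v * t) =
    \int[mu]_(t in `[0, T]) P t + \int[mu]_(t in `[0, T]) (logker r (v * t) - P t).
  rewrite -RintegralD//; last exact: (lintB lL lP T).
  by apply: eq_Rintegral => t _; rewrite addrC subrK.
rewrite (le_trans (ler_normD _ _))// lerD//.
  rewrite (le_trans (Rintegral_sum_cos_le _ _ v0 T0))//.
  apply: (@le_trans _ _ (4 / `|v| * \sum_(k < N) (k.+1%:R ^+ 2)^-1)).
    rewrite mulr_sumr ler_sum// => k _.
    have -> : 4 / `|v| * (k.+1%:R ^+ 2)^-1 = 2 / k.+1%:R * (2 / (k.+1%:R * `|v|)).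
      by field; rewrite normr_eq0 v0 addrC natr1 pnatr_eq0.
    rewrite ler_wpM2r// /logcoef !normrM normrX normrN1 expr1n mulr1 normfV normr_nat.
    rewrite normr_nat ler_wpM2r// ler_piMr// normrX (ger0_norm r0).
    by rewrite exprn_ile1// ltW.
  have -> : 8 / `|v| = 4 / `|v| * 2 by ring.
  by rewrite ler_wpM2l ?divr_ge0// sum_invsqr_le.
apply: le_trans hN.
have lB := lintB lL lP.
rewrite (le_trans (le_normr_Rintegral _ (lB T)))//.
apply: (@le_trans _ _ (\int[mu]_(t in `[0, T]) (4 * r ^+ N / (1 - r) ^+ 2))).
  apply: le_Rintegral => //; [exact: (lint_norm lB T)|exact: (lint_cst _ T)|].
  by move=> t _; exact: logker_series.
by rewrite Rintegral_cst//= lebesgue_measure_itv/= lte_fin T0 /= subr0.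
Qed.

End LogSeries.

(** * Null sets and the zeros of [2 + 2 cos] *)

Section NullSets.
Context {R : realType}.
Notation mu := (@lebesgue_measure R).
Implicit Types (f g : R -> R) (N : set R).

Lemma ae_integral_norm f g N (T : R) : measurable N -> mu N = 0%E ->
  measurable_fun setT f -> measurable_fun setT g -> (forall t, ~ N t -> f t = g t) ->
  (\int[mu]_(t in `[0%R, T]) `|f t|%:E = \int[mu]_(t in `[0%R, T]) `|g t|%:E)%E.
Proof.
move=> mN N0 mf mg fg; apply: ge0_ae_eq_integral => //.
- by apply/measurable_EFinP/measurable_funTS; exact: measurableT_comp.
- by apply/measurable_EFinP/measurable_funTS; exact: measurableT_comp.
- exists N; split=> // t /= /not_implyP[_ nfg]; apply: contrapT => /fg fgt.
  by apply: nfg; rewrite fgt.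
Qed.

Lemma null_lint f g N : measurable N -> mu N = 0%E ->
  measurable_fun setT f -> measurable_fun setT g -> (forall t, ~ N t -> f t = g t) ->
  lint f -> lint g.
Proof.
move=> mN N0 mf mg fg lf T; have /integrableP[_ fi] := lf T.
apply/integrableP; split; first by apply/measurable_EFinP/measurable_funTS.
by rewrite /comp/= -(ae_integral_norm T mN N0 mf mg fg).
Qed.

Lemma null_um f g N d : measurable N -> mu N = 0%E ->
  measurable_fun setT f -> measurable_fun setT g -> (forall t, ~ N t -> f t = g t) ->
  um f d -> um g d.
Proof.
move=> mN N0 mf mg fg uf e /uf; apply: filterS => T.
by rewrite /avg /Rintegral (ae_integral_norm T mN N0 mf mg fg).
Qed.

Lemma cosD2piz (x : R) (k : int) : cos (x + k%:~R * (pi *+ 2)) = cos x.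
Proof.
case: k => n; first by rewrite -pmulrn mulr_natl (periodicn (@cosD2pi R)).
rewrite NegzE rmorphN/= mulNr -pmulrn mulr_natl.
by rewrite -(periodicn (@cosD2pi R) n.+1 (x - _)) subrK.
Qed.

Lemma cos_eqN1 (x : R) : cos x = -1 -> exists k : int, x = pi + k%:~R * (pi *+ 2).
Proof.
move=> cx; have p0 : 0 < pi *+ 2 :> R by rewrite mulrn_wgt0// pi_gt0.
have pi0 := @pi_gt0 R.
pose k := Num.floor (x / (pi *+ 2)); exists k.
pose y := x - k%:~R * (pi *+ 2).
have xE : x = y + k%:~R * (pi *+ 2) by rewrite subrK.
have y0 : 0 <= y by rewrite subr_ge0 -ler_pdivlMr// floor_le_tmp.
have y2 : y < pi *+ 2.
  rewrite ltrBlDr -[X in X + _]mul1r -mulrDl -ltr_pdivrMr// addrC.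
  by rewrite -[1]/(1%:~R) -intrD floorD1_gt.
have cy : cos y = -1 by rewrite -cx xE cosD2piz.
suff yE : y = pi by rewrite -{1}yE.
have [yp|yp] := leP y pi.
  by apply/cos_inj; rewrite ?in_itv/= ?y0 ?yp ?(ltW pi0) ?lexx// cy cospi.
have : pi *+ 2 - y = pi; last by move: yp; rewrite mulr2n; lra.
apply: cos_inj; rewrite ?in_itv/= ?(ltW pi0) ?lexx//.
  by move: yp y2; rewrite mulr2n => *; apply/andP; split; lra.
by rewrite addrC cosD2pi cosN cy cospi.
Qed.

(** The times at which [2 + 2 cos (v t)] vanishes, singular for the logarithm. *)
Definition bad (v : R) : set R := [set t | cos (v * t) = -1].

Lemma bad_null v : v != 0 -> mu (bad v) = 0%E.
Proof.
move=> v0; apply: countable_lebesgue_measure0.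
have : bad v `<=` \bigcup_(k in [set: int]) [set (pi + k%:~R * (pi *+ 2)) / v].
  by move=> t /cos_eqN1[k tk]; exists k => //=; rewrite -tk mulrAC divff// mul1r.
move/subset_card_le/sub_countable; apply; apply: bigcup_countable => [|k _].
  exact: countableP.
exact: countable1.
Qed.

Lemma bad_measurable v : measurable (bad v).
Proof.
rewrite (_ : bad v = (fun t => cos (v * t + 0)) @^-1` [set -1]); last first.
  by apply/seteqP; split=> t /=; rewrite addr0.
rewrite -[X in measurable X]setTI.
have mc : measurable_fun setT (fun t : R => cos (v * t + 0)).
  by apply: continuous_measurable_fun; exact: continuous_cos_affine.
exact: mc.
Qed.
End NullSets.

(** * Integrability of [ln (2 + 2 cos)] and its distance in mean to the Abel regularisation *)

Section LogPotential.
Context {R : realType}.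
Notation mu := (@lebesgue_measure R).

Definition logpot (x : R) : R := ln (2 + 2 * cos x).

(* At the zeros of [2 + 2 cos], [logker'] takes the value [0] of [logpot], because
   [ln 0 = 0]; this makes the pointwise bounds and limits below valid everywhere. *)
Definition logker' (r v t : R) : R := if cos (v * t) == -1 then 0 else logker r (v * t).

Lemma measurable_cosM (v : R) : measurable_fun setT (fun t => cos (v * t)).
Proof.
apply: continuous_measurable_fun.
rewrite (_ : (fun t => cos (v * t)) = fun t => cos (v * t + 0)).
  exact: continuous_cos_affine.
by apply/funext => t; rewrite addr0.
Qed.

Lemma measurable_logpot (v : R) : measurable_fun setT (fun t => logpot (v * t)).
Proof.
apply: (@measurableT_comp _ _ _ _ _ _ (@ln R)); first exact: measurable_ln.
apply: measurable_funD => //; apply: measurable_funM => //; exact: measurable_cosM.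
Qed.

Lemma measurable_logker (r v : R) : measurable_fun setT (fun t => logker r (v * t)).
Proof.
apply: (@measurableT_comp _ _ _ _ _ _ (@ln R)); first exact: measurable_ln.
apply: measurable_funD => //; apply: measurable_funD => //.
by apply: measurable_funM => //; exact: measurable_cosM.
Qed.

Lemma measurable_logker' (r v : R) : measurable_fun setT (logker' r v).
Proof.
apply: measurable_fun_ifT => //; last exact: measurable_logker.
by apply: measurable_fun_eqr => //; exact: measurable_cosM.
Qed.

Lemma logker'E (r v t : R) : ~ bad v t -> logker r (v * t) = logker' r v t.
Proof. by move=> /eqP/negbTE nb; rewrite /logker' nb. Qed.

Lemma le_ln_ln4 (x : R) : 0 <= x <= 4 -> ln x <= ln 4.
Proof.
move=> /andP[]; rewrite le_eqVlt => /predU1P[<- _|x0 x4].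
  by rewrite ln0// ln_ge0// ler1n.
by rewrite ler_ln// posrE.
Qed.

Lemma logpot_le (x : R) : logpot x <= ln 4.
Proof.
by apply: le_ln_ln4; have := cos_geN1 x; have := cos_le1 x => *; apply/andP; split; lra.
Qed.

Lemma logker'_le (r v t : R) : 0 <= r < 1 -> logker' r v t <= ln 4.
Proof.
move=> r01; rewrite /logker'; case: ifP => _; first by rewrite ln_ge0// ler1n.
apply: le_ln_ln4; rewrite (ltW (logker_arg_gt0 _ r01))/=.
by have := cos_le1 (v * t); move: r01 => /andP[]; nra.
Qed.

Lemma lint_logker' (r v : R) : 0 <= r < 1 -> v != 0 -> lint (logker' r v).
Proof.
move=> r01 v0; apply: (null_lint (bad_measurable v) (bad_null v0) _ _ _ (lint_logker v r01)).
- exact: measurable_logker.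
- exact: measurable_logker'.
- by move=> t /logker'E.
Qed.

Lemma Rintegral_logker'_le (r v T : R) : 0 <= r < 1 -> v != 0 -> 0 < T ->
  `|\int[mu]_(t in `[0, T]) logker' r v t| <= 8 / `|v|.
Proof.
move=> r01 v0 T0.
suff -> : \int[mu]_(t in `[0, T]) logker' r v t = \int[mu]_(t in `[0, T]) logker r (v * t).
  exact: Rintegral_logker_le.
congr fine; apply: ae_eq_integral => //.
- by apply/measurable_EFinP/measurable_funTS; exact: measurable_logker'.
- by apply/measurable_EFinP/measurable_funTS; exact: measurable_logker.
- exists (bad v); split; [exact: bad_measurable|exact: bad_null|].
  move=> t /= /not_implyP[_ nE]; apply: contrapT => /(logker'E r) E.
  by apply: nE; rewrite E.
Qed.

Let rn (n : nat) : R := 1 - n.+2%:R^-1.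

Let rn01 n : 0 <= rn n < 1.
Proof.
by rewrite /rn subr_ge0 invf_le1 ?ltr0n// ler1n/= ltrBlDr ltrDl invr_gt0 ltr0n.
Qed.

Let cvg_rn : rn @ \oo --> (1 : R).
Proof.
rewrite -[X in _ --> X]subr0; apply: cvgB; first exact: cvg_cst.
by have := @cvg_harmonic R; rewrite -(cvg_shiftS (@harmonic R) (nbhs (0 : R))).
Qed.

Lemma cvg_logker' (v t : R) : logker' (rn n) v t @[n --> \oo] --> logpot (v * t).
Proof.
rewrite /logker'; have [cE|nE] := eqVneq (cos (v * t)) (-1).
  rewrite /logpot cE (_ : 2 + _ = 0) ?ln0//; last by ring.
  exact: cvg_cst.
have c0 : 0 < 2 + 2 * cos (v * t).
  have : -1 < cos (v * t) by rewrite lt_neqAle eq_sym nE cos_geN1.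
  lra.
apply: continuous_cvg; first exact: (continuous_ln c0).
have -> : 2 + 2 * cos (v * t) = 1 + 2 * 1 * cos (v * t) + 1 ^+ 2 by ring.
apply: cvgD; last by apply: (@continuous_cvg _ _ _ _ _ _ (fun x : R => x ^+ 2));
  [exact: exprn_continuous|exact: cvg_rn].
apply: cvgD; first exact: cvg_cst.
apply: cvgM; last exact: cvg_cst.
by apply: cvgM; [exact: cvg_cst|exact: cvg_rn].
Qed.

(** Fatou along [r -> 1] for [ln 4 - logker'], non-negative because [logker'] is at most [ln 4]. The
    bound serves twice: for the integrability of [logpot] and as a lower bound on its mean. *)
Lemma integral_logpot_le (v T : R) : v != 0 -> 0 < T ->
  (\int[mu]_(t in `[0%R, T]) (ln 4 - logpot (v * t))%:E <= (ln 4 * T + 8 / `|v|)%:E)%E.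
Proof.
move=> v0 T0.
pose f n t := (ln 4 - logker' (rn n) v t)%:E.
have mf n : measurable_fun `[0, T] (f n).
  apply/measurable_EFinP/measurable_funTS.
  by apply: measurable_funB => //; exact: measurable_logker'.
have f0 n t : `[0, T]%classic t -> (0 <= f n t)%E.
  by move=> _; rewrite lee_fin subr_ge0 logker'_le.
have fl t : limn_einf (f^~ t) = (ln 4 - logpot (v * t))%:E.
  apply: (cvg_limn_einf_sup _).1; apply: cvg_EFin; first exact: nearW.
  by apply: cvgB; [exact: cvg_cst|exact: cvg_logker'].
have := @fatou _ _ _ mu `[0, T] (measurable_itv _) f mf f0.
under eq_integral do rewrite fl.
move=> /le_trans; apply; rewrite limn_einf_lim.
apply: lime_le; first exact: is_cvg_einfs.
apply: nearW => n; apply: (@le_trans _ _ (\int[mu]_(x in `[0%R, T]) f n x)%E).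
  by apply: ereal_inf_lbound; exists n => /=.
have lL := lint_logker' (rn01 n) v0.
have lf : mu.-integrable `[0, T] (f n) := lintB (lint_cst (ln 4)) lL T.
rewrite -(fineK (integrable_fin_num _ lf))// lee_fin.
rewrite -[fine _]/(\int[mu]_(t in `[0, T]) (ln 4 - logker' (rn n) v t)).
rewrite RintegralB//; [|exact: (lint_cst (ln 4) T)].
rewrite Rintegral_cst//= lebesgue_measure_itv/= lte_fin T0 /= subr0 lerD2l.
by have := Rintegral_logker'_le (rn01 n) v0 T0; rewrite ler_norml => /andP[? _]; lra.
Qed.

Lemma lint_logpot (v : R) : v != 0 -> lint (fun t => logpot (v * t)).
Proof.
move=> v0; suff H : lint (fun t => ln 4 - logpot (v * t)).
  have := lintB (lint_cst (ln 4)) H; congr lint; apply/funext => t.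
  by rewrite subKr.
suff H T : 0 < T -> mu.-integrable `[0, T] (EFin \o (fun t => ln 4 - logpot (v * t))).
  move=> T; have [|T0] := ltP 0 T; first exact: H.
  apply: (@integrableS _ _ _ mu `[0, 1] `[0, T]) => //; last exact: (H 1 ltr01).
  by move=> t; rewrite /= !in_itv/= => /andP[-> h]; rewrite (le_trans h)// (le_trans T0).
move=> T0; apply/integrableP; split.
  apply/measurable_EFinP/measurable_funTS.
  by apply: measurable_funB => //; exact: measurable_logpot.
under eq_integral do rewrite /= ger0_norm ?subr_ge0 ?logpot_le//.
by rewrite (le_lt_trans (integral_logpot_le v0 T0))// ltry.
Qed.

(** Because [1 + 2 r cos + r^2 - r (2 + 2 cos) = (1 - r)^2]. *)
Lemma logpot_le_logker' (r v t : R) : 0 < r < 1 -> logpot (v * t) <= logker' r v t - ln r.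
Proof.
move=> /andP[r0 r1]; have lnr : ln r < 0 by rewrite ln_lt0// r0 r1.
rewrite /logker'; case: ifPn => [/eqP cE|nE].
  by rewrite /logpot cE (_ : 2 + _ = 0) ; [rewrite (ln0 (lexx 0)); lra|ring].
have c0 : 0 < 2 + 2 * cos (v * t).
  have : -1 < cos (v * t) by rewrite lt_neqAle eq_sym nE cos_geN1.
  lra.
rewrite lerBrDr -lnM ?posrE// ler_ln ?posrE ?mulr_gt0//; last first.
  by apply: logker_arg_gt0; rewrite ltW.
by rewrite -subr_ge0 (_ : _ - _ = (1 - r) ^+ 2) ?sqr_ge0//; ring.
Qed.

(** A one-sided pointwise bound becomes a bound in mean: [u = logker' - logpot] satisfies
    [u >= ln r] with [ln r < 0], so [|u| <= u - 2 ln r], and the integral of [u] over [[0, T]] is at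
    most [16 / |v|], half of it from each of the two functions. *)
Lemma um_logpotB (r v : R) : 0 < r < 1 -> v != 0 ->
  um (fun t => logpot (v * t) - logker r (v * t)) (- 2 * ln r).
Proof.
move=> r01 v0; have /andP[r0 r1] := r01.
have r01' : 0 <= r < 1 by rewrite ltW.
apply: (@null_um _ (fun t => logpot (v * t) - logker' r v t) _ (bad v)).
- exact: bad_measurable.
- exact: bad_null.
- by apply: measurable_funB; [exact: measurable_logpot|exact: measurable_logker'].
- by apply: measurable_funB; [exact: measurable_logpot|exact: measurable_logker].
- by move=> t /(logker'E r) ->.
have lX := lint_logpot v0; have lL := lint_logker' r01' v0.
have lnr : ln r < 0 by rewrite ln_lt0// r0 r1.
have v1 : 0 < `|v| by rewrite normr_gt0.
move=> e e0; near=> T.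
have T0 : 0 < T by near: T; exact: nbhs_pinfty_gt.
have Te : 16 / `|v| / e <= T by near: T; apply: nbhs_pinfty_ge; exact: num_real.
have lS : lint (fun t => logker' r v t - logpot (v * t)) := lintB lL lX.
apply: (@le_trans _ _ (avg T (fun t => (logker' r v t - logpot (v * t)) + - 2 * ln r))).
  apply: le_avg => //; [exact: (lint_norm (lintB lX lL))| |].
    by apply: lintD => //; exact: lint_cst.
  by move=> t; have := logpot_le_logker' v t r01; rewrite ler_norml => *;
    apply/andP; split; lra.
rewrite avgD//; last exact: lint_cst.
rewrite avg_cst// addrC lerD2l /avg ler_pdivrMl//.
apply: (@le_trans _ _ (16 / `|v|)); last by move: Te; rewrite ler_pdivrMr// (mulrC T).
have lC : lint (fun t => ln 4 - logpot (v * t)) := lintB (lint_cst (ln 4)) lX.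
have h : \int[mu]_(t in `[0, T]) (ln 4 - logpot (v * t)) <= ln 4 * T + 8 / `|v|.
  by rewrite -lee_fin /Rintegral fineK ?integral_logpot_le//; exact: (integrable_fin_num _ (lC T)).
move: h; rewrite !RintegralB//; [|exact: (lint_cst (ln 4) T)].
rewrite Rintegral_cst//= lebesgue_measure_itv/= lte_fin T0 /= subr0.
have := Rintegral_logker'_le r01' v0 T0; rewrite ler_norml => /andP[_ ?].
have -> : 16 / `|v| = 8 / `|v| + 8 / `|v| by field; rewrite gt_eqF.
lra.
Unshelve. all: by end_near. Qed.

End LogPotential.

(** * Truncation of the cosine series, uniformly in the number of frequencies *)

Section UniformApproximation.
Context {R : realType}.
Implicit Types (f h : R -> R) (c : R -> R) (s : seq R).

Lemma um_closed f d : (forall e, 0 < e -> um f (d + e)) -> um f d.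
Proof.
move=> uf e e0; have e2 : 0 < e / 2 by rewrite divr_gt0.
by have := uf _ e2 _ e2; apply: filterS => T; rewrite -addrA -splitr.
Qed.

(** Cauchy-Schwarz in the form [|f| <= D / 2 + f^2 / (2 D)], which is linear in the averages. *)
Lemma um_sqr f w D : 0 < D -> lint f -> lint (fun t => f t ^+ 2) ->
  time_avg_is (fun t => f t ^+ 2) w -> w <= D ^+ 2 -> um f D.
Proof.
move=> D0 lf lf2 /time_avgP fw wD e e0; near=> T.
have T0 : 0 < T by near: T; exact: nbhs_pinfty_gt.
have h : `|w - avg T (fun t => f t ^+ 2)| <= 2 * D * e.
  by near: T; apply: fw; rewrite !mulr_gt0.
apply: (@le_trans _ _ (avg T (fun t => D / 2 + (2 * D)^-1 * f t ^+ 2))).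
  apply: le_avg => //; first exact: lint_norm.
    by apply: lintD; [exact: lint_cst|exact: lintZ].
  move=> t; rewrite -(real_normK (num_real (f t))) -subr_ge0.
  rewrite (_ : _ - _ = (2 * D)^-1 * (D - `|f t|) ^+ 2).
    by rewrite mulr_ge0 ?sqr_ge0// invr_ge0 mulr_ge0// ltW.
  by field; rewrite gt_eqF.
rewrite avgD; [|exact: lint_cst|exact: lintZ].
rewrite avg_cst// avgZ//.
have : avg T (fun t => f t ^+ 2) <= D ^+ 2 + 2 * D * e.
  by move: h; rewrite ler_norml => /andP[h _]; lra.
move=> h2; apply: (@le_trans _ _ (D / 2 + (2 * D)^-1 * (D ^+ 2 + 2 * D * e))).
  by rewrite lerD2l ler_wpM2l// invr_ge0 mulr_ge0// ltW.
by rewrite le_eqVlt; apply/orP; left; apply/eqP; field; rewrite gt_eqF.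
Unshelve. all: by end_near. Qed.

Lemma linsumD h1 h2 c s t :
  linsum (fun x => h1 x + h2 x) c s t = linsum h1 c s t + linsum h2 c s t.
Proof.
by rewrite /linsum -big_split/=; apply: eq_bigr => v _; rewrite mulrDr.
Qed.

Lemma lint_linsum h c s : (forall v, v \in s -> lint (fun t => h (v * t))) ->
  lint (linsum h c s).
Proof.
elim: s => [|v s IH] H.
  rewrite (_ : linsum _ _ _ = fun=> 0); first exact: lint_cst.
  by apply/funext => t; rewrite /linsum big_nil.
rewrite (_ : linsum _ _ _ = fun t => c v * h (v * t) + linsum h c s t).
  apply: lintD; first by apply: lintZ; apply: H; rewrite mem_head.
  by apply: IH => y ys; apply: H; rewrite inE ys orbT.
by apply/funext => t; rewrite linsum_cons.
Qed.

Lemma um_linsum h c s d : (forall v, v \in s -> lint (fun t => h (v * t))) ->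
  (forall v, v \in s -> um (fun t => h (v * t)) d) ->
  um (linsum h c s) (d * \sum_(v <- s) `|c v|).
Proof.
elim: s => [|v s IH] lH uH.
  rewrite big_nil mulr0 (_ : linsum _ _ _ = fun=> 0).
    by apply: um_bounded => [|t]; [exact: lint_cst|rewrite normr0].
  by apply/funext => t; rewrite /linsum big_nil.
rewrite big_cons mulrDr (mulrC d `|_|).
rewrite (_ : linsum _ _ _ = fun t => c v * h (v * t) + linsum h c s t); last first.
  by apply/funext => t; rewrite linsum_cons.
have lHs y : y \in s -> lint (fun t => h (y * t)).
  by move=> ys; apply: lH; rewrite inE ys orbT.
have lv : lint (fun t => h (v * t)) by apply: lH; rewrite mem_head.
apply: umD; [exact: lintZ|exact: lint_linsum| |].
  by apply: umZ => //; apply: uH; rewrite mem_head.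
by apply: IH => // y ys; apply: uH; rewrite inE ys orbT.
Qed.

Lemma zindep_neq0 s v : zindep s -> v \in s -> v != 0.
Proof.
elim: s => [//|w s IH] /= [indw inds]; rewrite inE => /predU1P[->|]; last exact: IH.
apply/eqP => w0; apply: (indw 1) => //.
by rewrite w0 mulr0; exact: (zspan_subgroup s).1.
Qed.

Lemma sum_tail_le N M : (N <= M)%N ->
  \sum_(N <= k < M) (k.+1%:R ^+ 2)^-1 <= 2 / N.+1%:R :> R.
Proof.
move=> NM; suff H : \sum_(N <= k < M) (k.+1%:R ^+ 2)^-1 <= 2 / N.+1%:R - 2 / M.+1%:R :> R.
  by rewrite (le_trans H)// gerBl divr_ge0.
elim: M NM => [|M IH]; first by rewrite leqn0 => /eqP ->; rewrite big_geq// subrr.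
rewrite leq_eqVlt => /predU1P[->|NM]; first by rewrite big_geq// subrr.
rewrite big_nat_recr//= (le_trans (lerD (IH NM) (lexx _)))// -addrA lerD2l.
rewrite -[M.+2%:R]natr1; have := ler1n R M.+1; rewrite ltn0Sn.
move: (M.+1%:R : R) => /= w w1; have w0 : 0 < w by apply: lt_le_trans w1.
rewrite -subr_ge0 (_ : _ - _ = (w - 1) / (w ^+ 2 * (w + 1))).
  by rewrite divr_ge0 ?subr_ge0// mulr_ge0 ?sqr_ge0// addr_ge0// ltW.
by field; rewrite !gt_eqF// addr_gt0.
Qed.

(** Abel coefficients up to [M] against the limiting ones up to [N]. From [N] on one gets a tail of
    inverse squares, bounded without [r] or [M]; each earlier term carries a factor
    [1 - r^(k+1) <= 1 - r^N], which vanishes as [r -> 1] with [N] fixed. *)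
Lemma cosvar_logcoefB (r : R) N M : 0 < r < 1 -> (N <= M)%N ->
  cosvar (fun k => logcoef r k - (if (k < N)%N then logcoef 1 k else 0)) M <=
    4 / N.+1%:R + 2 * (N%:R * (1 - r ^+ N) ^+ 2).
Proof.
move=> /andP[r0 r1] NM; rewrite /cosvar -(big_mkord xpredT
  (fun k => (logcoef r k - (if (k < N)%N then logcoef 1 k else 0)) ^+ 2)).
rewrite (big_cat_nat (n := N))//= addrC.
have rX k : 0 <= r ^+ k <= 1 by rewrite exprn_ge0 ?exprn_ile1// ltW.
have -> : 4 / N.+1%:R + 2 * (N%:R * (1 - r ^+ N) ^+ 2) =
  2^-1 * (4 * (2 / N.+1%:R) + 4 * (\sum_(0 <= k < N) (1 - r ^+ N) ^+ 2)) :> R.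
  by rewrite sumr_const_nat subn0 -mulr_natl; field; rewrite addrC natr1 pnatr_eq0.
rewrite ler_wpM2l// lerD//.
  apply: (@le_trans _ _ (4 * \sum_(N <= k < M) (k.+1%:R ^+ 2)^-1)); last first.
    by rewrite ler_wpM2l// sum_tail_le.
  rewrite mulr_sumr !big_nat ler_sum// => k /andP[Nk _].
  rewrite ltnNge Nk subr0 /logcoef !exprMn exprVn -[_ ^+ k ^+ 2]exprM mulnC exprM sqrrN.
  rewrite expr1n expr1n mulr1 -mulrA (_ : 2 ^+ 2 = 4); last by ring.
  rewrite ler_wpM2l// ler_piMl ?invr_ge0 ?sqr_ge0//.
  by have /andP[? ?] := rX k.+1; rewrite exprn_ile1.
rewrite mulr_sumr !big_nat ler_sum// => k /andP[_ kN]; rewrite kN /logcoef expr1n mulr1.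
have -> : 2 * (-1) ^+ k * r ^+ k.+1 / k.+1%:R - 2 * (-1) ^+ k / k.+1%:R =
  2 * (-1) ^+ k / k.+1%:R * (r ^+ k.+1 - 1) :> R by ring.
rewrite !exprMn -[_ ^+ k ^+ 2]exprM mulnC exprM sqrrN expr1n expr1n mulr1.
rewrite (_ : 2 ^+ 2 = 4)//; last by ring.
rewrite -mulrA ler_wpM2l// -[leRHS]mul1r ler_pM ?sqr_ge0//.
  by rewrite exprVn invf_le1 ?exprn_gt0// exprn_ege1// ler1n.
have /andP[_ h1] := rX k.+1; have /andP[_ h2] := rX N.
rewrite -sqrrN opprB lerXn2r ?nnegrE ?subr_ge0// lerD2l lerN2.
by rewrite ler_wiXn2l// ltW.
Qed.

Lemma exists_r_close N (b e : R) : 0 <= b -> 0 < e ->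
  exists2 r : R, 0 < r < 1 & b * - ln r <= e /\ N%:R * (1 - r ^+ N) ^+ 2 <= e.
Proof.
move=> b0 e0.
have h1 : (fun r : R => b * - ln r) @ 1^'- --> b * - ln 1.
  apply: cvgM; first exact: cvg_cst.
  by apply: cvgN; apply: cvg_at_left_filter; apply: continuous_ln.
have h2 : (fun r : R => N%:R * (1 - r ^+ N) ^+ 2) @ 1^'- --> (N%:R * (1 - 1 ^+ N) ^+ 2 : R).
  apply: cvg_at_left_filter; apply: cvgM; first exact: cvg_cst.
  apply: (@continuous_comp _ _ _ (fun r : R => 1 - r ^+ N) (fun x => x ^+ 2)).
    by apply: cvgB; [exact: cvg_cst|exact: exprn_continuous].
  exact: exprn_continuous.
rewrite ln1 oppr0 mulr0 in h1; rewrite expr1n subrr expr0n/= mulr0 in h2.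
near ((1 : R)^'-) => r; exists r.
  by apply/andP; split; near: r; [exact: nbhs_left_gt|exact: nbhs_left_lt].
split; near: r.
  by have /cvgr_le/(_ e e0) := h1.
by have /cvgr_le/(_ e e0) := h2.
Unshelve. all: by end_near. Qed.

(** The errors in mean of [logpot - logker] and of [logker] minus its partial sum are multiples of
    [A], the sum of the [|c v|], which depends on [s]; they are absorbed by choosing [r], then [M],
    after [s]. The remaining polynomial is measured in mean square, where only the sum of the
    [c v ^ 2] enters, so the bound depends on [N] alone. *)
Lemma um_linsum_logpotB c s N : zindep s -> \sum_(v <- s) c v ^+ 2 <= 1 ->
  um (fun t => linsum logpot c s t - linsum (cospoly (logcoef 1) N) c s t)
    (Num.sqrt (4 / N.+1%:R)).
Proof.
move=> inds c1; apply: um_closed => e e0.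
set A := \sum_(v <- s) `|c v|; have A0 : 0 <= A by rewrite sumr_ge0.
have e4 : 0 < e / 4 by rewrite divr_gt0.
have e16 : 0 < (e / 4) ^+ 2 / 2 by rewrite divr_gt0// exprn_gt0.
(* One tolerance for [r]: the first entry is for the error in mean, the second for the squared error
   of the first [N] coefficients. *)
pose e' := Num.min (e / 4) ((e / 4) ^+ 2 / 2).
have e'0 : 0 < e' by rewrite lt_min e4 e16.
have [r r01 [hA hN]] := @exists_r_close N (2 * A) e' (mulr_ge0 (ler0n _ 2) A0) e'0.
move: hA hN; rewrite !le_min => /andP[hA _] /andP[_ hN].
have /andP[r0 r1] := r01; have r01' : 0 <= r < 1 by rewrite ltW.
have b0 : 0 < (1 - r) ^+ 2 by rewrite exprn_gt0// subr_gt0.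
have [M NM hM] : exists2 M, (N <= M)%N & 4 * r ^+ M / (1 - r) ^+ 2 * A <= e / 4.
  have : (fun N => 4 * r ^+ N / (1 - r) ^+ 2 * A) @ \oo --> (4 * 0 / (1 - r) ^+ 2 * A).
    apply: cvgM; last exact: cvg_cst.
    apply: cvgM; last exact: cvg_cst.
    by apply: cvgM; [exact: cvg_cst|apply: cvg_expr; rewrite gtr0_norm].
  rewrite mulr0 !mul0r => /cvgrPdist_le/(_ _ e4)[M _ hM].
  exists (maxn N M); first exact: leq_maxl.
  by apply: le_trans (hM _ (leq_maxr N M)); rewrite sub0r normrN; exact: ler_norm.
pose d k := logcoef r k - (if (k < N)%N then logcoef 1 k else 0).
pose h1 x := logpot x - logker r x.
pose h2 x := logker r x - cospoly (logcoef r) M x.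
have v0 v : v \in s -> v != 0 by exact: zindep_neq0.
have lint1 v : v \in s -> lint (fun t => h1 (v * t)).
  by move=> /v0 vn; apply: lintB; [exact: lint_logpot|exact: lint_logker].
have lint2 v : v \in s -> lint (fun t => h2 (v * t)).
  by move=> /v0 vn; apply: lintB; [exact: lint_logker|exact: lint_cospoly].
have um1 : um (linsum h1 c s) (- 2 * ln r * A).
  by apply: um_linsum => // v /v0 vn; exact: um_logpotB.
have um2 : um (linsum h2 c s) (4 * r ^+ M / (1 - r) ^+ 2 * A).
  apply: um_linsum => // v vs; apply: um_bounded => [|t]; first exact: lint2.
  exact: logker_series.
pose D : R := Num.sqrt (4 / N.+1%:R) + e / 4.
have D0 : 0 < D by rewrite ltr_wpDl// sqrtr_ge0.
have ap3 := @ap_linsum R d M c s.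
have um3 : um (linsum (cospoly d M) c s) D.
  apply: (@um_sqr _ (cosvar d M * \sum_(v <- s) c v ^+ 2) D D0 (lint_ap ap3)).
  - by apply: lint_continuous; apply: continuous_fsqr; exact: (ap_continuous ap3).
  - exact: time_avg_linsum_sqr.
  have s0 : 0 <= 4 / N.+1%:R :> R by rewrite divr_ge0.
  have := cosvar_logcoefB r01 NM; rewrite -/d => hd.
  have V0 : 0 <= cosvar d M by rewrite mulr_ge0// sumr_ge0// => k _; exact: sqr_ge0.
  apply: (@le_trans _ _ (cosvar d M)); first by rewrite ler_piMr.
  apply: (le_trans hd); rewrite [leRHS]sqrrD sqr_sqrtr//.
  have : 0 <= Num.sqrt (4 / N.+1%:R) * (e / 4) by rewrite mulr_ge0 ?sqrtr_ge0// ltW.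
  move: hN; set Q := N%:R * _; set S := Num.sqrt _; set F := 4 / _; set E := e / 4.
  lra.
have hd x : cospoly d M x = cospoly (logcoef r) M x - cospoly (logcoef 1) N x.
  rewrite /cospoly [X in _ = _ - X](big_ord_widen _
    (fun k => logcoef 1 k * cos (k.+1%:R * x)) NM) [X in _ = _ - X]big_mkcond/=.
  rewrite -sumrB; apply: eq_bigr => k _; rewrite /d.
  by case: ifP => _; rewrite mulrBl// mul0r.
have -> : (fun t => linsum logpot c s t - linsum (cospoly (logcoef 1) N) c s t) =
    (fun t => (linsum h1 c s t + linsum h2 c s t) + linsum (cospoly d M) c s t).
  apply/funext => t; rewrite -!linsumD.
  rewrite -[LHS]/(linsum logpot c s t + - linsum (cospoly (logcoef 1) N) c s t).
  rewrite /linsum -sumrB; apply: eq_bigr => v _.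
  by rewrite hd /h1 /h2; ring.
apply: um_mono (umD _ (lint_ap ap3) (umD _ _ um1 um2) um3).
- by rewrite /D; move: hA hM; lra.
- by apply: lintD; exact: lint_linsum.
- exact: lint_linsum.
- exact: lint_linsum.
Qed.

End UniformApproximation.

(** * The Basel sum *)

Section Basel.
Context {R : realType}.

Lemma inv_sinsqr_double (y : R) : sin y != 0 -> cos y != 0 ->
  (sin y ^+ 2)^-1 + (sin (pi / 2 - y) ^+ 2)^-1 = 4 / sin (2 * y) ^+ 2.
Proof.
move=> s0 c0; rewrite sinB sin_pihalf cos_pihalf mul1r mul0r subr0.
have -> : sin (2 * y) = 2 * (sin y * cos y).
  by rewrite (_ : 2 * y = y + y) ?sinD; ring.
have := cos2Dsin2 y; move: s0 c0; move: (sin y) (cos y) => s c s0 c0 sc.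
have -> : (s ^+ 2)^-1 + (c ^+ 2)^-1 = (c ^+ 2 + s ^+ 2) / (s ^+ 2 * c ^+ 2).
  by field; rewrite s0 c0.
by rewrite sc; field; rewrite s0 c0.
Qed.

(* Pairing [y] with [pi / 2 - y] and [inv_sinsqr_double] give the factor [4]. *)
Lemma sum_inv_sinsqr n :
  \sum_(k < 2 ^ n) (sin ((2 * k%:R + 1) * pi / (4 * 2 ^+ n)) ^+ 2)^-1 = 2 * 4 ^+ n :> R.
Proof.
elim: n => [|n IH].
  rewrite big_ord_recl big_ord0 !expr0 /= addr0 mulr0 add0r mul1r !mulr1.
  have e : pi / 4 = pi / 2 - pi / 4 :> R by field.
  have h : cos (pi / 4) = sin (pi / 4) :> R.
    by rewrite [in RHS]e sinB sin_pihalf cos_pihalf mul1r mul0r subr0.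
  have := @cos2Dsin2 R (pi / 4); rewrite h => h2.
  have -> : sin (pi / 4) ^+ 2 = 2^-1 :> R by lra.
  by rewrite invrK.
have m0 : 0 < 2 ^+ n :> R by rewrite exprn_gt0.
pose y (k : nat) : R := (2 * k%:R + 1) * pi / (4 * 2 ^+ n.+1).
have pi0 := @pi_gt0 R.
have yb k : (k < 2 ^ n)%N -> 0 < y k < pi / 2.
  move=> kn; rewrite /y exprS; apply/andP; split.
    by rewrite divr_gt0 ?mulr_gt0// ltr_wpDl// mulr_ge0.
  rewrite ltr_pdivrMr ?mulr_gt0//.
  have : k.+1%:R <= 2 ^+ n :> R by rewrite -natrX ler_nat.
  by rewrite -natr1; move: (2 ^+ n : R) m0 => w w0; nra.
rewrite -(big_mkord xpredT (fun k => (sin (y k) ^+ 2)^-1)) expnS mul2n -addnn.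
have shift m (F : nat -> R) : \sum_(m <= i < m + m) F i = \sum_(i < m) F (i + m)%N.
  by rewrite -{1}[m]add0n big_addn addnK big_mkord.
rewrite (big_cat_nat (n := 2 ^ n)) ?leq_addr//= shift big_mkord.
rewrite [X in _ + X](reindex_inj rev_ord_inj)/= -big_split/=.
rewrite [RHS](_ : _ = 4 * (2 * 4 ^+ n)); last by rewrite exprS; ring.
rewrite -IH mulr_sumr; apply: eq_bigr => k _.
have kn := ltn_ord k; have /andP[y0 y1] := yb k kn.
have -> : y (2 ^ n - k.+1 + 2 ^ n)%N = pi / 2 - y k.
  rewrite /y natrD natrB// natrX exprS -natr1.
  by move: (2 ^+ n : R) m0 => w w0; field; rewrite gt_eqF.
rewrite inv_sinsqr_double.
- congr (4 / sin _ ^+ 2); rewrite /y exprS.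
  by move: (2 ^+ n : R) m0 => w w0; field; rewrite gt_eqF.
- by rewrite gt_eqF// sin_gt0_pihalf// y0.
- by rewrite gt_eqF// cos_gt0_pihalf// y1 andbT; lra.
Qed.

(** The cubic bound gives [sin y >= y (1 - u)] with [u = y^2 / 6 < 2 / 3], and then
    [(1 - u)^(-2) <= 1 + 12 u]; after division by [y^2] the excess [12 u / y^2] is the constant
    [2]. *)
Lemma inv_sinsqr_bounds (y : R) : 0 < y < pi / 2 ->
  (y ^+ 2)^-1 <= (sin y ^+ 2)^-1 <= (y ^+ 2)^-1 + 2.
Proof.
move=> /andP[y0 y1]; have s0 : 0 < sin y by rewrite sin_gt0_pihalf// y0.
have y2 : y < 2 := lt_trans y1 (@pihalf_lt2 R).
apply/andP; split.
  rewrite lef_pV2 ?posrE ?exprn_gt0// lerXn2r ?nnegrE ?(ltW y0) ?(ltW s0)//.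
  by rewrite sin_le// ltW.
have h := sin_geBcube (ltW y0).
pose u := y ^+ 2 / 6; have u0 : 0 < u by rewrite /u divr_gt0// exprn_gt0.
have u1 : u < 2 / 3 by rewrite /u; nra.
have h' : y * (1 - u) <= sin y.
  by rewrite (_ : y * (1 - u) = y - y ^+ 3 / 6)// /u; field.
have yu : 0 < y * (1 - u) by rewrite mulr_gt0//; lra.
apply: (@le_trans _ _ ((y * (1 - u)) ^+ 2)^-1).
  by rewrite lef_pV2 ?posrE ?exprn_gt0// lerXn2r ?nnegrE ?(ltW yu) ?(ltW s0).
have -> : (y ^+ 2)^-1 + 2 = (1 + 12 * u) / y ^+ 2.
  by rewrite /u; field; rewrite gt_eqF.
rewrite exprMn invfM mulrC ler_wpM2r ?invr_ge0 ?sqr_ge0//.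
rewrite -[_^-1]mul1r ler_pdivrMr; last by rewrite exprn_gt0//; lra.
rewrite -subr_ge0 (_ : _ - _ = u * ((2 - 3 * u) * (5 - 4 * u))); last by ring.
by rewrite !mulr_ge0//; lra.
Qed.

(** Inverse squares of all integers and, in [O], of the odd ones, whose sum the sines at odd
    multiples give directly. *)
Let S (m : nat) : R := \sum_(k < m) (k.+1%:R ^+ 2)^-1.
Let O (m : nat) : R := \sum_(k < m) ((2 * k%:R + 1) ^+ 2)^-1.

Let S_double m : S m.*2 = O m + S m / 4.
Proof.
rewrite /S /O; elim: m => [|m IH]; first by rewrite !big_ord0; ring.
rewrite doubleS !big_ord_recr/= IH.
have -> : m.*2.+1%:R = 2 * m%:R + 1 :> R by rewrite -natr1 -mul2n natrM.
have -> : m.*2.+2%:R = 2 * m.+1%:R :> R by rewrite -doubleS -mul2n natrM.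
rewrite exprMn invfM; field; rewrite addrC natr1 pnatr_eq0/=.
by rewrite gt_eqF// ltr_wpDl// mulr_ge0.
Qed.

(** At the nodes [y k] the sum of [1 / y^2] is a multiple of [O (2 ^ n)] and the sum of [1 / sin^2]
    is known exactly; they differ by at most [2] per term. *)
Let O_bounds n : O (2 ^ n) <= pi ^+ 2 / 8 <= O (2 ^ n) + pi ^+ 2 / (8 * 2 ^+ n).
Proof.
have pi0 := @pi_gt0 R; have m0 : 0 < 2 ^+ n :> R by rewrite exprn_gt0.
pose y (k : nat) : R := (2 * k%:R + 1) * pi / (4 * 2 ^+ n).
have yb k : (k < 2 ^ n)%N -> 0 < y k < pi / 2.
  move=> kn; rewrite /y; apply/andP; split.
    by rewrite divr_gt0 ?mulr_gt0// ltr_wpDl// mulr_ge0.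
  rewrite ltr_pdivrMr ?mulr_gt0//.
  have : k.+1%:R <= 2 ^+ n :> R by rewrite -natrX ler_nat.
  by rewrite -natr1; move: (2 ^+ n : R) m0 => w w0; nra.
have OE : \sum_(k < 2 ^ n) (y k ^+ 2)^-1 = 16 * (2 ^+ n) ^+ 2 / pi ^+ 2 * O (2 ^ n).
  rewrite /O mulr_sumr; apply: eq_bigr => k _; rewrite /y.
  have : 0 < 2 * k%:R + 1 :> R by rewrite ltr_wpDl// mulr_ge0.
  move: (2 * k%:R + 1) (2 ^+ n : R) m0 (@pi R) pi0 => w z z0 p p0 w0.
  by field; rewrite !gt_eqF.
have h := sum_inv_sinsqr n.
have h1 : \sum_(k < 2 ^ n) (y k ^+ 2)^-1 <= 2 * 4 ^+ n.
  by rewrite -h ler_sum// => k _; have /andP[] := inv_sinsqr_bounds (yb k (ltn_ord k)).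
have h2 : 2 * 4 ^+ n <= \sum_(k < 2 ^ n) (y k ^+ 2)^-1 + 2 * 2 ^+ n.
  have -> : 2 * 2 ^+ n = \sum_(k < 2 ^ n) 2 :> R.
    by rewrite sumr_const card_ord -[RHS]mulr_natr natrX.
  rewrite -h -big_split/= ler_sum// => k _.
  by have /andP[] := inv_sinsqr_bounds (yb k (ltn_ord k)).
have e4 : 4 ^+ n = (2 ^+ n) ^+ 2 :> R by rewrite -exprM mulnC exprM; congr (_ ^+ _); ring.
move: h1 h2; rewrite OE e4; move: (O _) (2 ^+ n : R) m0 (@pi R) pi0 => o w w0 p p0.
have w2 : 0 < 16 * w ^+ 2 / p ^+ 2 by rewrite divr_gt0 ?mulr_gt0 ?exprn_gt0.
move=> h1 h2; apply/andP; split.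
  rewrite -(ler_pM2l w2) (le_trans h1)// le_eqVlt; apply/orP; left; apply/eqP.
  by field; rewrite gt_eqF.
rewrite -(ler_pM2l w2) mulrDr (le_trans _ (le_trans h2 _))//.
  by rewrite le_eqVlt; apply/orP; left; apply/eqP; field; rewrite gt_eqF.
by rewrite lerD2l le_eqVlt; apply/orP; left; apply/eqP; field; rewrite !gt_eqF.
Qed.

(** The value [pi^2 / 6] is the fixed point of [x = pi^2 / 8 + x / 4], the limit form of [S_double].
    At each doubling, a quarter of the previous bound and an equal error from the odd sum make up
    half of the previous bound. *)
Lemma basel n :
  `|\sum_(k < 2 ^ n) (k.+1%:R ^+ 2)^-1 - pi ^+ 2 / 6| <= pi ^+ 2 / (2 * 2 ^+ n) :> R.
Proof.
rewrite -/(S _); have pi2 := @pi_ge2 R.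
elim: n => [|n IH].
  rewrite /S expn0 big_ord_recl big_ord0/= expr1n invr1 addr0 expr0 mulr1.
  by rewrite ler_norml; apply/andP; split; nra.
have m0 : 0 < 2 ^+ n :> R by rewrite exprn_gt0.
rewrite expnS mul2n S_double; have /andP[q1 q2] := O_bounds n.
move: IH; rewrite ler_norml => /andP[s1 s2].
have e2 : pi ^+ 2 / (8 * 2 ^+ n) = (pi ^+ 2 / 2 ^+ n) / 8 :> R.
  by move: (pi ^+ 2) (2 ^+ n : R) m0 => p w w0; field; rewrite gt_eqF.
have e3 : pi ^+ 2 / (2 * 2 ^+ n) = (pi ^+ 2 / 2 ^+ n) / 2 :> R.
  by move: (pi ^+ 2) (2 ^+ n : R) m0 => p w w0; field; rewrite gt_eqF.
have e4 : pi ^+ 2 / (2 * 2 ^+ n.+1) = (pi ^+ 2 / 2 ^+ n) / 4 :> R.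
  by rewrite (exprS 2); move: (pi ^+ 2) (2 ^+ n : R) m0 => p w w0; field; rewrite gt_eqF.
rewrite e4; rewrite e3 in s1 s2; rewrite e2 in q2.
have : 0 < pi ^+ 2 / 2 ^+ n :> R by rewrite divr_gt0// exprn_gt0// pi_gt0.
move: (@pi R ^+ 2 / 2 ^+ n) (@pi R ^+ 2) (S _) (O _) s1 s2 q1 q2 => p q s o *.
by rewrite ler_norml; apply/andP; split; lra.
Qed.

End Basel.

(** * Fourier transform of the normal density *)

Lemma normal_pdf0E (R : realType) (s x : R) : s != 0 ->
  normal_pdf 0 s x = normal_peak s * expR (- (2 * s ^+ 2)^-1 * x ^+ 2).
Proof.
move=> s0; rewrite normal_pdfE// /normal_fun subr0; congr (_ * expR _).
by rewrite -mulr_natl mulNr mulrC mulNr.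
Qed.

Section GaussianFourier.
Context {R : realType}.
Notation mu := (@lebesgue_measure R).
Context (s : R) (s0 : s != 0).
Notation p := (normal_pdf 0 s).

Lemma integrable_mul_normal_pdf (g : R -> R) (M : R) : measurable_fun setT g ->
  (forall x, `|g x| <= M) -> mu.-integrable setT (EFin \o (fun x => g x * p x)).
Proof.
move=> mg gM; apply: (@le_integrable _ _ _ mu setT measurableT _
  (fun x => M%:E * (p x)%:E)%E).
- apply/measurable_EFinP; apply: measurable_funM => //; exact: measurable_normal_pdf.
- move=> x _ /=; rewrite lee_fin normrM [leRHS]normrM.
  by rewrite ler_wpM2r// (le_trans (gM x))// ler_norm.
- by apply: integrableZl => //; exact: integrable_normal_pdf.
Qed.

(** Half of the Gaussian exponent absorbs [|x|]: with [y = x^2 / (4 s^2)],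
    [|x| <= |s| (1 + y) <= |s| exp y], so a multiple of the normal density of variance [2 s^2]
    dominates. *)
Lemma integrable_abs_normal_pdf :
  mu.-integrable setT (EFin \o (fun x => `|x| * p x)).
Proof.
have q0 : Num.sqrt 2 * s != 0 by rewrite mulf_neq0// gt_eqF// sqrtr_gt0.
pose C := `|s| * normal_peak s / normal_peak (Num.sqrt 2 * s).
apply: (@le_integrable _ _ _ mu setT measurableT _
  (fun x => C%:E * (normal_pdf 0 (Num.sqrt 2 * s) x)%:E)%E).
- apply/measurable_EFinP; apply: measurable_funM; last exact: measurable_normal_pdf.
  by apply: continuous_measurable_fun; exact: norm_continuous.
- move=> x _ /=; rewrite lee_fin.
  rewrite [leRHS]ger0_norm; last first.
    by rewrite mulr_ge0 ?normal_pdf_ge0// divr_ge0 ?normal_peak_ge0// mulr_ge0 ?normal_peak_ge0.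
  rewrite ger0_norm ?mulr_ge0 ?normal_pdf_ge0// !normal_pdf0E//.
  have -> e : C * (normal_peak (Num.sqrt 2 * s) * e) = normal_peak s * (`|s| * e).
    by rewrite /C; field; rewrite gt_eqF// normal_peak_gt0.
  rewrite mulrCA ler_wpM2l ?normal_peak_ge0// exprMn sqr_sqrtr//.
  set y := x ^+ 2 / (4 * s ^+ 2).
  have -> : - (2 * (2 * s ^+ 2))^-1 * x ^+ 2 = - y by rewrite /y; field.
  have -> : - (2 * s ^+ 2)^-1 * x ^+ 2 = - y - y by rewrite /y; field.
  rewrite expRD mulrA ler_wpM2r ?expR_ge0//.
  rewrite expRN ler_pdivrMr ?expR_gt0//.
  have s1 : 0 < `|s| by rewrite normr_gt0.
  apply: (@le_trans _ _ (`|s| * (1 + y))); last by rewrite ler_wpM2l// expR_ge1Dx.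
  have -> : y = (`|x| / (2 * `|s|)) ^+ 2.
    rewrite /y -(real_normK (num_real x)) -(real_normK (num_real s)).
    by field; rewrite gt_eqF.
  have {1}-> : `|x| = `|s| * (2 * (`|x| / (2 * `|s|))) by field; rewrite gt_eqF.
  rewrite ler_pM2l//; move: (`|x| / _) => z.
  by rewrite -subr_ge0 (_ : _ - _ = (1 - z) ^+ 2) ?sqr_ge0//; ring.
- by apply: integrableZl => //; exact: integrable_normal_pdf.
Qed.

Lemma der_normal_pdf (x : R) : is_derive x (1 : R) p (- (s ^+ 2)^-1 * x * p x).
Proof.
rewrite (_ : p = fun y => normal_peak s * expR (- (2 * s ^+ 2)^-1 * y ^+ 2)).
  by notypeclasses refine (der_eq _ _); [der|simpl; field].
by apply/funext => y; rewrite normal_pdf0E.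
Qed.

Lemma measurable_continuousR (f : R -> R) : continuous f -> measurable_fun setT f.
Proof. exact: continuous_measurable_fun. Qed.

Lemma Rintegral_segment_cvg (f : R -> R) : mu.-integrable setT (EFin \o f) ->
  (fun n : nat => \int[mu]_(x in `[- n%:R, n%:R]) f x) @ \oo --> \int[mu]_x f x.
Proof.
move=> fi; have mf : measurable_fun setT f.
  by apply/measurable_EFinP; case/integrableP : fi.
pose fn (n : nat) := f \_ `[- n%:R, n%:R].
have H : (\int[mu]_x (fn n x)%:E)%E @[n --> \oo] --> (\int[mu]_x (f x)%:E)%E.
  apply: (@dominated_cvg _ _ _ mu setT measurableT
    (fun n x => (fn n x)%:E) (EFin \o f) (fun x => `|f x|%:E)) => //.
  - move=> n; apply/measurable_EFinP; apply/(measurable_restrictT _ _).1 => //.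
    exact: measurable_funTS.
  - move=> x _; apply: cvg_EFin; first exact: nearW.
    apply: cvg_near_cst; near=> n; rewrite /= /fn patchE mem_set//= in_itv/=.
    have : `|x| <= n%:R by near: n; exact: nbhs_infty_ger.
    by rewrite ler_norml.
  - by have := integrable_norm fi.
  - move=> n x _; rewrite lee_fin /fn patchE; case: ifP => _ //.
    by rewrite normr0.
have fin : (\int[mu]_x (f x)%:E)%E \is a fin_num by exact: integrable_fin_num fi.
rewrite -(fineK fin) in H.
rewrite (_ : (fun n : nat => _) = fine \o (fun n => (\int[mu]_x (fn n x)%:E)%E)).
  exact: fine_cvg H.
apply/funext => n /=; rewrite /Rintegral [in LHS]integral_mkcond.
by under eq_integral do rewrite restrict_EFin.
Unshelve. all: by end_near. Qed.

Lemma cos_affine_le (xi al x : R) : `|cos (xi * x + al)| <= 1.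
Proof. exact: cos_max. Qed.

Lemma measurable_cos_affine (xi al : R) : measurable_fun setT (fun x => cos (xi * x + al)).
Proof. by apply: measurable_continuousR; exact: continuous_cos_affine. Qed.

Lemma continuous_sin_affine (xi al : R) : continuous (fun x : R => sin (xi * x + al)).
Proof.
under eq_fun do rewrite -cosBpihalf -addrA; exact: continuous_cos_affine.
Qed.

Lemma integrable_sin_normal_pdf (xi al : R) :
  mu.-integrable setT (EFin \o (fun x => x * sin (xi * x + al) * p x)).
Proof.
apply: (@le_integrable _ _ _ mu setT measurableT _ (EFin \o (fun x => `|x| * p x))).
- apply/measurable_EFinP; apply: measurable_funM; last exact: measurable_normal_pdf.
  apply: measurable_funM => //.
  by apply: measurable_continuousR; exact: continuous_sin_affine.
- move=> x _ /=; rewrite lee_fin !normrM normr_id ler_wpM2r// ler_piMr// sin_max//.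
- exact: integrable_abs_normal_pdf.
Qed.

Lemma cvg_normal_pdf : (fun n : nat => p n%:R) @ \oo --> (0 : R).
Proof.
apply/cvgrPdist_le => e e0; near=> n.
rewrite sub0r normrN ger0_norm ?normal_pdf_ge0// normal_pdf0E// mulNr expRN.
have pk : 0 < normal_peak s by exact: normal_peak_gt0.
have n1 : 1 <= n%:R :> R by near: n; exact: nbhs_infty_ger.
have ss : 0 < s ^+ 2 by rewrite exprn_even_gt0.
have ne : 2 * s ^+ 2 * normal_peak s / e <= n%:R by near: n; exact: nbhs_infty_ger.
rewrite ler_pdivrMr ?expR_gt0//.
apply: (@le_trans _ _ (e * ((2 * s ^+ 2)^-1 * n%:R ^+ 2))); last first.
  by rewrite ler_wpM2l ?(ltW e0)// (le_trans _ (expR_ge1Dx _))// lerDr.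
have -> : e * ((2 * s ^+ 2)^-1 * n%:R ^+ 2) = (n%:R * e) * n%:R / (2 * s ^+ 2) by ring.
rewrite ler_pdivlMr; last by rewrite pmulr_rgt0.
move: ne; rewrite ler_pdivrMr// => ne.
rewrite mulrC (le_trans ne)// ler_peMr// mulr_ge0// ltW//.
Unshelve. all: by end_near. Qed.

(** The difference of the two integrands is the derivative of [- s^2 sin (xi x + al) p x], whose
    values at [n] and [-n] tend to [0]. *)
Lemma gauss_by_parts (xi al : R) :
  \int[mu]_x (x * sin (xi * x + al) * p x) =
  s ^+ 2 * xi * \int[mu]_x (cos (xi * x + al) * p x).
Proof.
have i1 := integrable_sin_normal_pdf xi al.
have i2 := @integrable_mul_normal_pdf _ 1 (measurable_cos_affine xi al)
  (cos_affine_le xi al).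
have i3 : mu.-integrable setT (EFin \o (fun x => s ^+ 2 * xi * (cos (xi * x + al) * p x))).
  exact: (@integrableZl _ _ _ mu setT measurableT (s ^+ 2 * xi) _ i2).
rewrite -RintegralZl//; apply/eqP; rewrite -subr_eq0 -RintegralB//.
pose h x := x * sin (xi * x + al) * p x - s ^+ 2 * xi * (cos (xi * x + al) * p x).
have ih : mu.-integrable setT (EFin \o h).
  exact: (@integrableB _ _ _ mu setT measurableT _ _ i1 i3).
have dH x : is_derive x (1 : R) (fun x => - s ^+ 2 * (sin (xi * x + al) * p x)) (h x).
  have dp := der_normal_pdf x.
  have ds : is_derive x (1 : R) (fun x => sin (xi * x + al)) (xi * cos (xi * x + al)).
    by notypeclasses refine (der_eq _ _); [der|simpl; ring].
  notypeclasses refine (der_eq (der_M (der_cst x _) (der_M ds dp)) _).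
  by rewrite /h; field.
have cp : continuous p by exact: continuous_normal_pdf.
have ch : continuous h.
  move=> x; apply: cvgB.
    apply: cvgM; last exact: cp.
    by apply: cvgM; [exact: cvg_id|exact: continuous_sin_affine].
  apply: cvgM; first exact: cvg_cst.
  by apply: cvgM; [exact: continuous_cos_affine|exact: cp].
have := Rintegral_segment_cvg ih.
have h0 : (fun n : nat => \int[mu]_(x in `[- n%:R, n%:R]) h x) @ \oo --> (0 : R).
  have hc : (fun n : nat => s ^+ 2 * (2 * p n%:R)) @ \oo --> (s ^+ 2 * (2 * 0) : R).
    apply: cvgM; first exact: cvg_cst.
    by apply: cvgM; [exact: cvg_cst|exact: cvg_normal_pdf].
  rewrite !mulr0 in hc; apply/norm_cvg0P.
  apply: (@squeeze_cvgr _ _ _ _ (fun=> 0) (fun n : nat => s ^+ 2 * (2 * p n%:R))) => //;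
    last exact: cvg_cst.
  near=> n; rewrite normr_ge0/=.
  have n0 : 0 < n%:R :> R by near: n; exact: nbhs_infty_gtr.
  rewrite (Rintegral_FTC _ ch dH); last by lra.
  have -> : p (- n%:R) = p n%:R by rewrite !normal_pdf0E// sqrrN.
  rewrite -mulrBr -mulrBl normrM normrN (ger0_norm (sqr_ge0 s)) ler_wpM2l ?sqr_ge0//.
  rewrite normrM (ger0_norm (normal_pdf_ge0 _ _ _)) ler_wpM2r ?normal_pdf_ge0//.
  rewrite (le_trans (ler_normB _ _))//.
  by have := sin_max (xi * n%:R + al); have := sin_max (xi * - n%:R + al); lra.
by move=> h1; apply/eqP; exact: (cvg_unique _ h1 h0).
Unshelve. all: by end_near. Qed.

(* By parts, the integral solves [I' xi = - s^2 xi I xi] with [I 0 = cos al]. *)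
Lemma gauss_fourier (xi al : R) :
  \int[mu]_x (cos (xi * x + al) * p x) = expR (- (s ^+ 2 * xi ^+ 2 / 2)) * cos al.
Proof.
pose I (z : R) := \int[mu]_x (cos (z * x + al) * p x).
have dI z : is_derive z (1 : R) I (- (s ^+ 2 * z) * I z).
  pose f (w x : R) := cos (w * x + al) * p x.
  have df (w x : R) : is_derive w (1 : R) (f ^~ x) (- (x * sin (w * x + al) * p x)).
    have dc : is_derive w (1 : R) (fun w => cos (w * x + al)) (- (x * sin (w * x + al))).
      by notypeclasses refine (der_eq _ _); [der|simpl; ring].
    notypeclasses refine (der_eq (der_M dc (der_cst w (p x))) _).
    by simpl; ring.
  have hi w : `](z - 1), (z + 1)[%classic w -> mu.-integrable setT (EFin \o f w).
    move=> _; exact: (integrable_mul_normal_pdf (measurable_cos_affine w al)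
      (cos_affine_le w al)).
  have hz : `](z - 1), (z + 1)[%classic z by rewrite /= in_itv/=; apply/andP; split; lra.
  have hd w x : `](z - 1), (z + 1)[%classic w -> setT x -> derivable (f ^~ x) w 1.
    by move=> _ _; case: (df w x).
  have hG x : 0 <= `|x| * p x by rewrite mulr_ge0// normal_pdf_ge0.
  have hub w x : `](z - 1), (z + 1)[%classic w -> setT x ->
      `|partial1of2 f w x| <= `|x| * p x.
    move=> _ _; rewrite partial1of2E (derive_val (is_derive := df w x)).
    rewrite normrN !normrM (ger0_norm (normal_pdf_ge0 _ _ _)) ler_wpM2r ?normal_pdf_ge0//.
    by rewrite ler_piMr// sin_max.
  have D := @derivable_under_integral R _ _ mu f setT measurableT z (z - 1) (z + 1)
    hz hi hd _ hG integrable_abs_normal_pdf hub.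
  have E := @differentiation_under_integral R _ _ mu f setT measurableT z (z - 1) (z + 1)
    hz hi hd _ hG integrable_abs_normal_pdf hub.
  apply: DeriveDef; first exact: D.
  rewrite -derive1E E.
  transitivity (\int[mu]_x (-1 * (x * sin (z * x + al) * p x))).
    apply: eq_Rintegral => x _; rewrite partial1of2E (derive_val (is_derive := df z x)).
    by rewrite mulN1r.
  rewrite RintegralZl//; last exact: integrable_sin_normal_pdf.
  by rewrite gauss_by_parts mulN1r mulNr.
(* Integrating factor: the differential equation makes this product constant. *)
have dJ z : is_derive z (1 : R) (fun z => expR (s ^+ 2 * z ^+ 2 / 2) * I z) 0.
  have de : is_derive z (1 : R) (fun z => expR (s ^+ 2 * z ^+ 2 / 2))
      (s ^+ 2 * z * expR (s ^+ 2 * z ^+ 2 / 2)).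
    by notypeclasses refine (der_eq _ _); [der|simpl; field].
  notypeclasses refine (der_eq (der_M de (dI z)) _).
  by ring.
have := is_derive_0_is_cst xi 0 dJ.
rewrite expr0n/= mulr0 mul0r expR0 mul1r => JE.
have I0 : I 0 = cos al.
  rewrite /I; under eq_Rintegral do rewrite mul0r add0r.
  rewrite RintegralZl//; last exact: integrable_normal_pdf.
  by rewrite /Rintegral integral_normal_pdf mulr1.
rewrite -I0 -JE mulrA -expRD addNr expR0 mul1r//.
Qed.

End GaussianFourier.

(** * Convergence in law from characteristic functions *)

Section Levy.
Context {R : realType}.
Notation mu := (@lebesgue_measure R).

Lemma triangle3 (x y z w e : R) :
  `|x - y| <= e / 3 -> `|y - z| <= e / 3 -> `|z - w| <= e / 3 -> `|x - w| <= e.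
Proof.
rewrite !ler_norml => /andP[? ?] /andP[? ?] /andP[? ?].
by apply/andP; split; lra.
Qed.

(* [x |-> asin (sin (b x)) / b] is the identity on [[-K, K]], and a continuous function
   of [sin (b x)] is almost periodic. *)
Lemma trig_approx (g : R -> R) (M K e : R) : continuous g -> (forall x, `|g x| <= M) ->
  0 < K -> 0 < e ->
  exists r : seq (R * R * R), forall x, `|g x - trigsum r x| <= e + 2 * M / K * `|x|.
Proof.
move=> cg gM K0 e0; have pi0 := @pi_gt0 R.
have M0 : 0 <= M := le_trans (normr_ge0 _) (gM 0).
pose w : R := sin (pi / 4).
have w0 : 0 < w by apply: sin_gt0_pihalf; apply/andP; split; lra.
have w1 : w < 1.
  rewrite -(@sin_pihalf R) ltr_sin ?in_itv/=; [lra| |]; apply/andP; split; lra.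
pose b := pi / (4 * K); have b0 : 0 < b by rewrite divr_gt0// mulr_gt0.
(* The clamp keeps the argument of [asin] strictly between [-1] and [1], so that [H] is continuous
   on the whole line; it is inactive when [|b x| <= pi / 4], that is [|x| <= K]. *)
pose clamp (y : R) := Num.max (- w) (Num.min y w).
have clampE y : - 1 < clamp y < 1.
  rewrite /clamp lt_max gt_max gt_min w1 orbT andbT.
  by apply/andP; split; [apply/orP; left; lra|lra].
have cclamp : continuous clamp.
  move=> y; apply: (@continuous_max _ _ (fun=> - w) (fun y => Num.min y w)); first exact: cvg_cst.
  by apply: (@continuous_min _ _ (fun y => y) (fun=> w)); [exact: cvg_id|exact: cvg_cst].
pose H (y : R) := g (asin (clamp y) / b).
have cH : continuous H.
  move=> y; apply: (@continuous_comp _ _ _ (fun y => asin (clamp y) / b) g); last exact: cg.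
  apply: cvgM; last exact: cvg_cst.
  apply: (@continuous_comp _ _ _ clamp (@asin R)); first exact: cclamp.
  by apply: continuous_asin; exact: clampE.
have TG : is_subgroup [set: R] by split.
have apsin : ap [set: R] (fun x => sin (b * x)).
  apply: ap_ext (@ap_cos _ _ b (- (pi / 2)) _) => // x.
  by rewrite cosBpihalf.
have [r _ hr] := ap_comp TG cH apsin e0; exists r => x.
(* Outside [[-K, K]] the trivial bound [2 M] is at most [2 M |x| / K]. *)
have [xK|xK] := leP `|x| K; last first.
  have := hr x; have := gM x; have := gM (asin (clamp (sin (b * x))) / b).
  rewrite -/(H _) => h1 h2 /= h3.
  have h4 : 2 * M <= 2 * M / K * `|x|.
    by rewrite -mulrA ler_peMr ?mulr_ge0// mulrC ler_pdivlMr// mul1r ltW.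
  rewrite -(subrK (H (sin (b * x))) (g x)) -addrA.
  rewrite (le_trans (ler_normD _ _))//.
  have := ler_normB (g x) (H (sin (b * x))); lra.
have := hr x => /= h; rewrite (_ : g x = H (sin (b * x))).
  by apply: (le_trans h); rewrite lerDl mulr_ge0// divr_ge0// ?mulr_ge0// ltW.
have bK : `|b * x| <= pi / 4.
  rewrite normrM gtr0_norm// (_ : pi / 4 = b * K) ?ler_pM2l//.
  by rewrite /b invfM mulrA divfK ?gt_eqF.
move: bK; rewrite ler_norml => /andP[bx1 bx2].
have in4 : - (pi / 4 : R) \in `[(- (pi / 2)), (pi / 2 : R)].
  by rewrite in_itv/=; apply/andP; split; lra.
have in4' : (pi / 4 : R) \in `[(- (pi / 2)), (pi / 2 : R)].
  by rewrite in_itv/=; apply/andP; split; lra.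
have inbx : b * x \in `[(- (pi / 2)), (pi / 2 : R)].
  by rewrite in_itv/=; apply/andP; split; lra.
have s1 : - w <= sin (b * x) by rewrite /w -sinN leNgt ltr_sin// -leNgt.
have s2 : sin (b * x) <= w by rewrite /w leNgt ltr_sin// -leNgt.
rewrite /H /clamp (min_idPl s2) (max_idPr s1) sinK//.
by rewrite mulrC mulKf// gt_eqF.
Qed.

Lemma Rintegral_trigsum_normal_pdf (s : R) (r : seq (R * R * R)) : s != 0 ->
  \int[mu]_x (trigsum r x * normal_pdf 0 s x) =
  \sum_(z <- r) z.1.1 * (expR (- (s ^+ 2 * z.1.2 ^+ 2 / 2)) * cos z.2).
Proof.
move=> s0; have ic (z : R * R * R) : mu.-integrable setT
    (EFin \o (fun x => cos (z.1.2 * x + z.2) * normal_pdf 0 s x)).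
  exact: (integrable_mul_normal_pdf s (measurable_cos_affine z.1.2 z.2)
    (cos_affine_le z.1.2 z.2)).
rewrite (eq_bigr (fun z : R * R * R => z.1.1 *
  \int[mu]_x (cos (z.1.2 * x + z.2) * normal_pdf 0 s x))); last first.
  by move=> z _; rewrite gauss_fourier.
have it r' : mu.-integrable setT (EFin \o (fun x => trigsum r' x * normal_pdf 0 s x)).
  apply: (integrable_mul_normal_pdf s _ (trigsum_le r')).
  by apply: measurable_continuousR; exact: continuous_trigsum.
elim: r => [|z r IH].
  rewrite big_nil; under eq_Rintegral do rewrite /trigsum big_nil mul0r.
  by rewrite /Rintegral integral0.
rewrite big_cons -IH -RintegralZl// -RintegralD//; last first.
  exact: (@integrableZl _ _ _ mu setT measurableT z.1.1 _ (ic z)).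
by apply: eq_Rintegral => x _; rewrite /trigsum big_cons; ring.
Qed.

(** Tightness is the common bound [A] on the upper mean of [|F L|], matched by the first absolute
    moment [B] of the normal law: both make the linear error of the trigonometric approximation
    small for large [K]. *)
Lemma levy (F : nat -> R -> R) (s A : R) : s != 0 -> 0 <= A ->
  (forall L, lint (F L)) -> (forall L, um (F L) A) ->
  (forall L, measurable_fun setT (F L)) ->
  (forall xi al, exists a : nat -> R,
    (forall L, time_avg_is (fun t => cos (xi * F L t + al)) (a L)) /\
    a @ \oo --> expR (- (s ^+ 2 * xi ^+ 2 / 2)) * cos al) ->
  time_avg_cvg_in_law_normal F s.
Proof.
move=> s0 A0 lF uF mF HF g cg [M gM].
have M0 : 0 <= M := le_trans (normr_ge0 _) (gM 0).
have lg L : lint (fun t => g (F L t)).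
  apply: (@lint_bounded _ _ M) => //.
  by apply: measurableT_comp => //; exact: measurable_continuousR.
pose B := \int[mu]_x (`|x| * normal_pdf 0 s x).
have B0 : 0 <= B by apply: Rintegral_ge0 => x _; rewrite mulr_ge0// normal_pdf_ge0.
have lcos L xi al : lint (fun t => cos (xi * F L t + al)).
  apply: (@lint_bounded _ _ 1) => [|t]; last exact: cos_max.
  apply: (@measurableT_comp _ _ _ _ _ _ (fun x => cos (xi * x + al))) => //.
  exact: measurable_cos_affine.
have lt L r : lint (fun t => trigsum r (F L t)).
  apply: (@lint_bounded _ _ (\sum_(z <- r) `|z.1.1|)) => [|t]; last exact: trigsum_le.
  apply: (@measurableT_comp _ _ _ _ _ _ (trigsum r)) => //.
  by apply: measurable_continuousR; exact: continuous_trigsum.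
have Ht (r : seq (R * R * R)) : exists a : nat -> R,
    (forall L, time_avg_is (fun t => trigsum r (F L t)) (a L)) /\
    a @ \oo --> \int[mu]_x (trigsum r x * normal_pdf 0 s x).
  rewrite Rintegral_trigsum_normal_pdf//; elim: r => [|z r [a [ha la]]].
    exists (fun=> 0); split; last by rewrite big_nil; exact: cvg_cst.
    by move=> L; under eq_fun do rewrite /trigsum big_nil; exact: time_avg_cst.
  have [b [hb lb]] := HF z.1.2 z.2.
  exists (fun L => z.1.1 * b L + a L); split; last first.
    rewrite big_cons; apply: cvgD => //.
    by apply: cvgM => //; exact: cvg_cst.
  move=> L; under eq_fun do rewrite /trigsum big_cons.
  by apply: time_avgD; [exact: lintZ|exact: lt|exact: time_avgZ|exact: ha].
have approx e : 0 < e -> exists r : seq (R * R * R),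
    (forall L, um (fun t => g (F L t) - trigsum r (F L t)) e) /\
    `|\int[mu]_x (trigsum r x * normal_pdf 0 s x) -
      \int[mu]_x (g x * normal_pdf 0 s x)| <= e.
  move=> e0; have e2 : 0 < e / 2 by rewrite divr_gt0.
  (* Makes [2 M (A + B) / K] at most [e / 2]; the added ones keep [K] positive. *)
  pose K := 4 * (M + 1) * (A + B + 1) / e.
  have K0 : 0 < K by rewrite divr_gt0// !mulr_gt0 ?ltr_wpDl// addr_ge0.
  have KE : 2 * M / K * (A + B) <= e / 2.
    rewrite (_ : _ / K * _ = 2 * M * (A + B) / K); last by ring.
    rewrite ler_pdivrMr// /K.
    have -> : e / 2 * (4 * (M + 1) * (A + B + 1) / e) = 2 * (M + 1) * (A + B + 1).
      by field; rewrite gt_eqF.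
    by lra.
  have MK0 : 0 <= 2 * M / K by apply: divr_ge0; [rewrite mulr_ge0|exact: ltW].
  have KA : 2 * M / K * A <= e / 2.
    by apply: le_trans KE; rewrite ler_wpM2l// lerDl.
  have KB : 2 * M / K * B <= e / 2.
    by apply: le_trans KE; rewrite ler_wpM2l// lerDr.
  have [r1 hr] := trig_approx cg gM K0 e2; exists r1; split.
    move=> L; apply: (@um_mono _ _ (e / 2 + `|2 * M / K| * A)).
      by rewrite ger0_norm//; lra.
    have l1 : lint (fun t => 2 * M / K * `|F L t|) := lintZ _ (lint_norm (lF L)).
    apply: (@um_le _ _ (fun t => e / 2 + 2 * M / K * `|F L t|)).
    - exact: lintB.
    - by apply: lintD => //; exact: lint_cst.
    - move=> t; rewrite (le_trans (hr _))// [leRHS]ger0_norm//.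
      by apply: addr_ge0; [exact: ltW|exact: mulr_ge0].
    apply: umD => //; [exact: lint_cst| |].
      by apply: um_bounded => [|t]; [exact: lint_cst|rewrite ger0_norm// ltW].
    apply: umZ; first exact: lint_norm.
    apply: um_le (uF L) => //; first exact: lint_norm.
    by move=> t; rewrite normr_id.
  have i1 : mu.-integrable setT (EFin \o (fun x => trigsum r1 x * normal_pdf 0 s x)).
    apply: (integrable_mul_normal_pdf s _ (trigsum_le r1)).
    by apply: measurable_continuousR; exact: continuous_trigsum.
  have i2 : mu.-integrable setT (EFin \o (fun x => g x * normal_pdf 0 s x)).
    by apply: (integrable_mul_normal_pdf s _ gM); exact: measurable_continuousR.
  have i3 : mu.-integrable setT (EFin \o (fun x => e / 2 * normal_pdf 0 s x)).
    exact: (@integrableZl _ _ _ mu setT measurableT (e / 2) _ (integrable_normal_pdf 0 s)).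
  have i4 := integrable_abs_normal_pdf s0.
  have i5 : mu.-integrable setT
      (EFin \o (fun x => 2 * M / K * (`|x| * normal_pdf 0 s x))).
    exact: (@integrableZl _ _ _ mu setT measurableT (2 * M / K) _ i4).
  have i6 : mu.-integrable setT (EFin \o (fun x => trigsum r1 x * normal_pdf 0 s x -
      g x * normal_pdf 0 s x)).
    exact: (@integrableB _ _ _ mu setT measurableT _ _ i1 i2).
  have i7 : mu.-integrable setT (EFin \o (fun x => e / 2 * normal_pdf 0 s x +
      2 * M / K * (`|x| * normal_pdf 0 s x))).
    exact: (@integrableD _ _ _ mu setT measurableT _ _ i3 i5).
  rewrite -RintegralB// (le_trans (le_normr_Rintegral _ i6))//.
  apply: (@le_trans _ _ (\int[mu]_x (e / 2 * normal_pdf 0 s x +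
      2 * M / K * (`|x| * normal_pdf 0 s x)))).
    apply: le_Rintegral => //; first exact: (integrable_norm i6).
    move=> x _; rewrite -mulrBl normrM distrC (ger0_norm (normal_pdf_ge0 _ _ _)).
    by rewrite (mulrA (2 * M / K)) -mulrDl ler_wpM2r ?normal_pdf_ge0.
  rewrite RintegralD// RintegralZl// RintegralZl//; last exact: (integrable_normal_pdf 0 s).
  rewrite -/B {1}/Rintegral integral_normal_pdf mulr1.
  by lra.
have ex L : exists a, time_avg_is (fun t => g (F L t)) a.
  apply: time_avg_exists => // e e0; have [r [h _]] := approx e e0.
  have [a [ha _]] := Ht r.
  by exists (fun t => trigsum r (F L t)); split=> //; exists (a L).
have [a ha] := choice ex; exists a; split=> //.
apply/cvgrPdist_le => e e0; have e3 : 0 < e / 3 by rewrite divr_gt0.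
have [r [h1 h2]] := approx _ e3; have [b [hb lb]] := Ht r.
have /cvgrPdist_le/(_ _ e3) := lb; apply: filterS => L h3.
have h4 : `|a L - b L| <= e / 3 := time_avg_close (lg L) (lt L r) (ha L) (hb L) (h1 L).
rewrite distrC in h2; rewrite distrC in h4; exact: triangle3 h2 h3 h4.
Qed.
End Levy.

(** * The partition function *)

Section PartitionFunction.
Import complex.ComplexField.
Context {R : realType}.
Notation C := (complex.complex R).

Definition cis (x : R) : C := complex.Complex (cos x) (sin x).
Definition nsq (z : C) : R := complex.Re z ^+ 2 + complex.Im z ^+ 2.

Lemma cisD (x y : R) : cis (x + y) = cis x * cis y.
Proof. by rewrite /cis cosD sinD; congr complex.Complex; rewrite addrC. Qed.

Lemma cis_sum (I : Type) (r : seq I) (f : I -> R) :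
  cis (\sum_(i <- r) f i) = \prod_(i <- r) cis (f i).
Proof.
elim: r => [|i r IH]; first by rewrite !big_nil /cis cos0 sin0.
by rewrite !big_cons cisD IH.
Qed.

Lemma nsqM (z w : C) : nsq (z * w) = nsq z * nsq w.
Proof. by case: z w => a b [c d]; rewrite /nsq /=; ring. Qed.

Lemma nsq_prod (I : Type) (r : seq I) (f : I -> C) :
  nsq (\prod_(i <- r) f i) = \prod_(i <- r) nsq (f i).
Proof.
elim: r => [|i r IH]; first by rewrite !big_nil /nsq /= expr1n expr0n addr0.
by rewrite !big_cons nsqM IH.
Qed.

Lemma Re_sum (I : Type) (r : seq I) (f : I -> C) :
  complex.Re (\sum_(i <- r) f i) = \sum_(i <- r) complex.Re (f i).
Proof.
elim: r => [|i r IH]; first by rewrite !big_nil.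
by rewrite !big_cons -IH; case: (f i) (\sum_(j <- r) f j) => a b [].
Qed.

Lemma Im_sum (I : Type) (r : seq I) (f : I -> C) :
  complex.Im (\sum_(i <- r) f i) = \sum_(i <- r) complex.Im (f i).
Proof.
elim: r => [|i r IH]; first by rewrite !big_nil.
by rewrite !big_cons -IH; case: (f i) (\sum_(j <- r) f j) => a b [].
Qed.

(** The sum over occupations factors mode by mode, and the phase of [E0] has modulus one. The sum of
    [cis] used here is the complex conjugate of the trace, with the same modulus. *)
Lemma chi_abs2_prod (L : nat) (E0 : R) (Lam : 'I_L -> R) (t : R) :
  chi_abs2 E0 Lam t = \prod_(k < L) (2 + 2 * cos (t * Lam k)).
Proof.
transitivity (nsq (\sum_(n : occ L) cis (t * energy E0 Lam n))).
  rewrite /nsq Re_sum Im_sum /chi_abs2; congr (_ + _).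
  by rewrite -sqrrN -sumrN; congr (_ ^+ 2); apply: eq_bigr => n _; rewrite sinN opprK.
have -> : \sum_(n : occ L) cis (t * energy E0 Lam n) =
    cis (t * E0) * \prod_(k < L) (1 + cis (t * Lam k)).
  transitivity (cis (t * E0) *
    \sum_(n : occ L) \prod_(k < L) (if n k then cis (t * Lam k) else 1)).
    rewrite mulr_sumr; apply: eq_bigr => n _.
    rewrite /energy mulrDr cisD mulr_sumr cis_sum; congr (_ * _).
    apply: eq_bigr => k _; case: (n k); first by rewrite mul1r.
    by rewrite mul0r mulr0 /cis cos0 sin0.
  congr (_ * _).
  rewrite -(bigA_distr_bigA (fun (k : 'I_L) (b : bool) => if b then cis (t * Lam k) else 1)).
  by apply: eq_bigr => k _; rewrite big_bool addrC.
rewrite nsqM nsq_prod {1}/nsq /= cos2Dsin2 mul1r.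
apply: eq_bigr => k _; rewrite /nsq /= add0r.
have := cos2Dsin2 (t * Lam k); move: (cos _) (sin _) => c s cs.
transitivity (1 + 2 * c + (c ^+ 2 + s ^+ 2)); first by ring.
by rewrite cs; ring.
Qed.

Lemma sum_distinct (L : nat) (Lam : 'I_L -> R) (phi : R -> R) :
  \sum_(k < L) phi (Lam k) =
  \sum_(v <- distinct_energies Lam) (mult Lam v)%:R * phi v.
Proof.
transitivity (\sum_(v <- distinct_energies Lam) \sum_(k < L | Lam k == v) phi v); last first.
  apply: eq_bigr => v _; rewrite sumr_const mulr_natl; congr (_ *+ _).
  by rewrite /mult; apply: eq_card => k; apply/idP/idP => [h|/set_mem//]; exact: mem_set.
rewrite (exchange_big_dep xpredT)//=; apply: eq_bigr => k _.
rewrite (eq_bigl (pred1 (Lam k))); last by move=> v /=; rewrite eq_sym.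
rewrite -big_filter filter_pred1_uniq ?undup_uniq ?big_seq1//.
by rewrite mem_undup map_f// mem_enum.
Qed.

Lemma zspan_sum (s : seq R) (w : R) : zspan s w ->
  exists c : nat -> int, w = \sum_(i < size s) (c i)%:~R * s`_i.
Proof.
elim: s w => [w /= ->|v s IH w /= [z /IH[c cE]]].
  by exists (fun=> 0); rewrite big_ord0.
exists (fun i => if i is j.+1 then c j else z).
by rewrite big_ord_recl/= -cE addrC subrK.
Qed.

(** A non-zero integer multiple of the head lying in the group of the tail is a rational relation
    with non-zero head coefficient. *)
Lemma Q_lin_indep_zindep (s : seq R) : Q_lin_indep s -> zindep s.
Proof.
elim: s => [//|v s IH] Qs /=; split.
  move=> z z0 /zspan_sum[c cE].
  pose d (i : 'I_(size (v :: s))) : rat :=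
    if val i is j.+1 then - (c j)%:~R else z%:~R.
  have /(_ ord0) : forall i, d i = 0.
    apply: Qs; rewrite big_ord_recl/= /d/= ratr_int cE -[RHS](subrr
      (\sum_(i < size s) (c i)%:~R * s`_i)); congr (_ + _).
    by rewrite -sumrN; apply: eq_bigr => i _; rewrite rmorphN/= ratr_int mulNr.
  by rewrite /d/= => /eqP; rewrite intr_eq0 (negbTE z0).
apply: IH => c cs i.
pose d (i : 'I_(size (v :: s))) : rat :=
  if unlift ord0 i is Some j then c j else 0.
have /(_ (lift ord0 i)) : forall i, d i = 0; last by rewrite /d liftK.
apply: Qs; rewrite big_ord_recl/= /d unlift_none rmorph0 mul0r add0r -[RHS]cs.
by apply: eq_bigr => j _; rewrite liftK.
Qed.

End PartitionFunction.

(** * The central limit theorem *)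

Section CentralLimit.
Context {R : realType}.
Notation mu := (@lebesgue_measure R).

Lemma le_sum_mem (s : seq R) (f : R -> R) v : (forall x, 0 <= f x) -> v \in s ->
  f v <= \sum_(x <- s) f x.
Proof. by move=> f0 vs; rewrite (big_rem v)//= lerDl sumr_ge0. Qed.

Lemma expRN_lipschitz (a b : R) : 0 <= a -> 0 <= b ->
  `|expR (- a) - expR (- b)| <= `|a - b|.
Proof.
wlog ab : a b / a <= b => [H a0 b0|a0 b0].
  have [|/ltW] := leP a b => ab; first exact: H.
  by rewrite distrC (distrC a); exact: H.
have e1 : expR (- a) <= 1 by rewrite -expR0 ler_expR oppr_le0.
have -> : expR (- a) - expR (- b) = expR (- a) * (1 - expR (a - b)).
  by rewrite mulrBr mulr1 -expRD addrA addNr add0r.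
have h := expR_ge1Dx (a - b).
have h' : expR (a - b) <= 1 by rewrite -expR0 ler_expR subr_le0.
rewrite normrM (ger0_norm (expR_ge0 _)) ger0_norm ?subr_ge0// distrC ger0_norm ?subr_ge0//.
apply: (@le_trans _ _ (1 - expR (a - b))); last by lra.
by rewrite ler_piMl// subr_ge0.
Qed.

Lemma cosvar_logcoef1 N : cosvar (logcoef 1) N = 2 * \sum_(k < N) (k.+1%:R ^+ 2)^-1 :> R.
Proof.
rewrite /cosvar [RHS](_ : _ = 2^-1 * (4 * \sum_(k < N) (k.+1%:R ^+ 2)^-1)); last by field.
congr (_ * _); rewrite mulr_sumr; apply: eq_bigr => k _.
rewrite /logcoef expr1n mulr1 !exprMn exprVn -[_ ^+ k ^+ 2]exprM mulnC exprM sqrrN.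
by rewrite !expr1n mulr1 (_ : 2 ^+ 2 = 4)//; ring.
Qed.

Lemma expn2_large (x : R) : exists n, x <= 2 ^+ n.
Proof.
exists (Num.truncn x).+1; apply: (le_trans (ltW (truncnS_gt x))).
by rewrite -natrX ler_nat ltnW// ltn_expl.
Qed.

Lemma exists_dyadic (x : R) : exists n, forall m, (n <= m)%N -> x <= 2 ^+ m.
Proof.
have [n hn] := expn2_large x; exists n => m nm; apply: (le_trans hn).
by rewrite ler_eXn2l// ltr1n.
Qed.

(** The degree [2 ^ n] is fixed before [L] grows. Three errors remain: truncation, uniform in [L];
    Lindeberg's, at most [K] times the largest weight; and the gap between twice the partial sum of
    inverse squares and [pi^2 / 3], controlled along powers of two. The normalisation is an equality
    only for large [L], because at [L = 0] there are no energies. *)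
Lemma clt_cos (F : nat -> R -> R) (s : nat -> seq R) (c : nat -> R -> R) (xi al : R) :
  (forall L, measurable_fun setT (F L)) ->
  (forall L, zindep (s L)) -> (forall L, \sum_(v <- s L) c L v ^+ 2 <= 1) ->
  (\forall L \near \oo, \sum_(v <- s L) c L v ^+ 2 = 1) ->
  (forall eta, 0 < eta -> \forall L \near \oo, forall v, v \in s L -> `|c L v| <= eta) ->
  (forall L, lint (F L)) ->
  (forall L N, um (fun t => F L t - linsum (cospoly (logcoef 1) N) (c L) (s L) t)
     (Num.sqrt (4 / N.+1%:R))) ->
  exists a : nat -> R, (forall L, time_avg_is (fun t => cos (xi * F L t + al)) (a L)) /\
    a @ \oo --> expR (- (pi ^+ 2 / 3 * xi ^+ 2 / 2)) * cos al.
Proof.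
move=> mF inds c1 c1' csmall lF uF.
have lf L : lint (fun t => cos (xi * F L t + al)).
  apply: (@lint_bounded _ _ 1) => [|t]; last exact: cos_max.
  apply: (@measurableT_comp _ _ _ _ _ _ (fun x => cos (xi * x + al))) => //.
  exact: measurable_cos_affine.
have cle L v : v \in s L -> `|c L v| <= 1.
  move=> vs; rewrite -(@expr_le1 _ 2)// real_normK ?num_real//.
  by apply: le_trans (c1 L); apply: (le_sum_mem (f := fun v => c L v ^+ 2)) => // x;
    exact: sqr_ge0.
pose S N := cospoly (@logcoef R 1) N.
have lg L N : lint (linsum (S N) (c L) (s L)) := lint_ap (ap_linsum _ _ _ _).
have lcg L N : lint (fun t => cos (xi * linsum (S N) (c L) (s L) t + al)).
  apply: lint_continuous => t.
  apply: (@continuous_comp _ _ _ (linsum (S N) (c L) (s L)) (fun x => cos (xi * x + al))).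
    exact: (ap_continuous (ap_linsum _ _ _ _)).
  exact: continuous_cos_affine.
have ucos L N : um (fun t => cos (xi * F L t + al) -
    cos (xi * linsum (S N) (c L) (s L) t + al)) (`|xi| * Num.sqrt (4 / N.+1%:R)).
  have lB := lintB (lF L) (lg L N).
  apply: (um_le _ _ _ (@umZ _ xi _ _ lB (uF L N))).
  - by apply: lintB.
  - exact: lintZ.
  - move=> t; rewrite (le_trans (cos_lipschitz _ _))// opprD addrACA subrr addr0.
    by rewrite mulrBr.
have Dsmall e : 0 < e -> exists n, forall m, (n <= m)%N ->
    `|xi| * Num.sqrt (4 / (2 ^ m).+1%:R) <= e.
  move=> e0; have d0 : 0 < e / (`|xi| + 1) by rewrite divr_gt0// ltr_wpDl.
  have [n hn] := exists_dyadic (4 / (e / (`|xi| + 1)) ^+ 2); exists n => m /hn hm.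
  apply: (@le_trans _ _ (`|xi| * (e / (`|xi| + 1)))).
    rewrite ler_wpM2l// -(ger0_norm (ltW d0)) -sqrtr_sqr ler_wsqrtr//.
    move: hm; rewrite ler_pdivrMr ?exprn_gt0// => hm.
    rewrite ler_pdivrMr// mulrC (le_trans hm)// ler_wpM2r ?sqr_ge0//.
    by rewrite -natrX ler_nat.
  by rewrite mulrCA ler_piMr ?(ltW e0)// ler_pdivrMr ?ltr_wpDl// mul1r lerDl.
have ex L : exists a, time_avg_is (fun t => cos (xi * F L t + al)) a.
  apply: time_avg_exists => // e e0; have [n /(_ n (leqnn n)) hn] := Dsmall e e0.
  exists (fun t => cos (xi * linsum (S (2 ^ n)%N) (c L) (s L) t + al)); split=> //.
    have [K _ HK] := lindeberg (@logcoef R 1) (2 ^ n) xi al.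
    by have [m hm _] := HK (c L) (s L) (inds L) (cle L); exists m.
  by apply: um_mono (ucos L (2 ^ n)%N).
have [a ha] := choice ex; exists a; split=> //.
apply/cvgrPdist_le => e e0; have e3 : 0 < e / 3 by rewrite divr_gt0.
have [n1 hn1] := Dsmall _ e3.
have [n2 hn2] := exists_dyadic (xi ^+ 2 * pi ^+ 2 / 2 / (e / 3)).
pose n := maxn n1 n2; have hd := hn1 n (leq_maxl _ _).
have hv := hn2 n (leq_maxr _ _).
have [K K0 HK] := lindeberg (@logcoef R 1) (2 ^ n) xi al.
have eta0 : 0 < e / 3 / (K + 1) by rewrite divr_gt0// ltr_wpDl.
near=> L.
have cL1 : \sum_(v <- s L) c L v ^+ 2 = 1 by near: L; exact: c1'.
have ceta : forall v, v \in s L -> `|c L v| <= e / 3 / (K + 1) by near: L; exact: csmall.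
have [m hm mE] := HK (c L) (s L) (inds L) (cle L).
have am : `|a L - m| <= e / 3.
  apply: (le_trans _ hd).
  exact: time_avg_close (lf L) (lcg L (2 ^ n)%N) (ha L) hm (ucos L (2 ^ n)%N).
have S3 : K * \sum_(v <- s L) `|c L v| ^+ 3 <= e / 3.
  apply: (@le_trans _ _ (K * (e / 3 / (K + 1)))); last first.
    by rewrite mulrCA ler_piMr ?(ltW e3)// ler_pdivrMr ?ltr_wpDl// mul1r lerDl.
  rewrite ler_wpM2l// -[leRHS]mulr1 -[X in _ <= _ * X]cL1 mulr_sumr big_seq [leRHS]big_seq.
  apply: ler_sum => v vs.
  have -> : `|c L v| ^+ 3 = `|c L v| * c L v ^+ 2.
    by rewrite -(real_normK (num_real (c L v))) -exprS.
  by rewrite ler_wpM2r ?sqr_ge0// ceta.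
set V := cosvar (@logcoef R 1) (2 ^ n) in mE.
rewrite cL1 mulr1 in mE.
have VE : `|expR (- (pi ^+ 2 / 3 * xi ^+ 2 / 2)) * cos al -
    expR (- (xi ^+ 2 * V / 2)) * cos al| <= e / 3.
  rewrite -mulrBl normrM (le_trans (ler_piMr _ (cos_max al)))//.
  have V0 : 0 <= V by rewrite /V mulr_ge0// sumr_ge0// => k _; exact: sqr_ge0.
  rewrite (le_trans (expRN_lipschitz _ _))//.
  - by rewrite divr_ge0// mulr_ge0 ?sqr_ge0// divr_ge0// sqr_ge0.
  - by rewrite divr_ge0// mulr_ge0// sqr_ge0.
  have b := @basel R n; rewrite /V cosvar_logcoef1.
  set B := \sum_(k < _) _ in b *.
  have -> : pi ^+ 2 / 3 * xi ^+ 2 / 2 - xi ^+ 2 * (2 * B) / 2 =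
      xi ^+ 2 * (pi ^+ 2 / 6 - B) by move: (@pi R ^+ 2) => p; field.
  rewrite normrM (ger0_norm (sqr_ge0 xi)) distrC.
  apply: (le_trans (ler_wpM2l (sqr_ge0 xi) b)).
  move: hv; rewrite ler_pdivrMr// => hv.
  rewrite mulrA ler_pdivrMr ?mulr_gt0 ?exprn_gt0//.
  by move: hv; rewrite ler_pdivrMr//; lra.
have mE' : `|m - expR (- (xi ^+ 2 * V / 2)) * cos al| <= e / 3 := le_trans mE S3.
rewrite distrC in mE'; rewrite distrC in am.
exact: triangle3 VE mE' am.
Unshelve. all: by end_near. Qed.

End CentralLimit.

(** * The normalised logarithm of the partition function *)

Section EchoLaw.
Context {R : realType}.
Notation mu := (@lebesgue_measure R).

Definition weight (L : nat) (Lam : 'I_L -> R) (v : R) : R :=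
  (mult Lam v)%:R / Num.sqrt (sum_g2 Lam).

Lemma sum_g2_ge0 (L : nat) (Lam : 'I_L -> R) : 0 <= sum_g2 Lam.
Proof. by rewrite sumr_ge0// => v _; exact: sqr_ge0. Qed.

Lemma weight_ge0 (L : nat) (Lam : 'I_L -> R) v : 0 <= weight Lam v.
Proof. by rewrite divr_ge0 ?sqrtr_ge0. Qed.

(** A quotient rather than [1]: at [L = 0] there is no energy and, [0 / 0] being [0], both sides
    vanish. *)
Lemma sum_weight_sqr (L : nat) (Lam : 'I_L -> R) :
  \sum_(v <- distinct_energies Lam) weight Lam v ^+ 2 = sum_g2 Lam / sum_g2 Lam.
Proof.
rewrite [in RHS]/sum_g2 mulr_suml; apply: eq_bigr => v _.
by rewrite /weight exprMn exprVn sqr_sqrtr ?sum_g2_ge0.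
Qed.

Lemma sum_g2_gt0 (L : nat) (Lam : 'I_L -> R) : (0 < L)%N -> 0 < sum_g2 Lam.
Proof.
case: L Lam => // L Lam _; set v := Lam ord0.
have vs : v \in distinct_energies Lam by rewrite mem_undup map_f// mem_enum.
apply: lt_le_trans (le_sum_mem (f := fun v => (mult Lam v)%:R ^+ 2) _ vs).
  rewrite exprn_gt0// ltr0n /mult; apply/card_gt0P; exists ord0.
  by apply: mem_set; rewrite /= eqxx.
by move=> x; exact: sqr_ge0.
Qed.

Lemma ln_prod (I : eqType) (r : seq I) (f : I -> R) : (forall i, i \in r -> 0 < f i) ->
  0 < \prod_(i <- r) f i /\ ln (\prod_(i <- r) f i) = \sum_(i <- r) ln (f i).
Proof.
elim: r => [|i r IH] f0; first by rewrite !big_nil ln1.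
have [|p0 pE] := IH; first by move=> j jr; apply: f0; rewrite inE jr orbT.
have fi : 0 < f i by apply: f0; rewrite mem_head.
by rewrite !big_cons mulr_gt0// lnM ?posrE// pE.
Qed.

Definition badset (s : seq R) : set R := \big[setU/set0]_(v <- s) bad v.

Lemma badset_measurable s : measurable (badset s).
Proof. by apply: bigsetU_measurable => v _; exact: bad_measurable. Qed.

Lemma badset_null s : (forall v, v \in s -> v != 0) -> mu (badset s) = 0%E.
Proof.
elim: s => [_|v s IH v0]; first by rewrite /badset big_nil measure0.
rewrite /badset big_cons null_set_setU//.
- exact: bad_measurable.
- exact: badset_measurable.
- by apply: bad_null; apply: v0; rewrite mem_head.
- by apply: IH => w ws; apply: v0; rewrite inE ws orbT.
Qed.

Lemma mem_badset s v t : v \in s -> bad v t -> badset s t.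
Proof.
elim: s => [//|w s IH]; rewrite inE /badset big_cons => /predU1P[->|vs] bt.
  by left.
by right; exact: IH.
Qed.

Definition echo (E0 : R) (L : nat) (Lam : 'I_L -> R) (t : R) : R :=
  ln (chi_abs2 E0 Lam t) / Num.sqrt (sum_g2 Lam).

(** Off the zeros the logarithm of the product is the sum of the logarithms. At a zero this may
    fail, [ln 0] being [0], but the zeros form a null set. *)
Lemma echo_linsum (E0 : R) (L : nat) (Lam : 'I_L -> R) (t : R) :
  ~ badset (distinct_energies Lam) t ->
  echo E0 Lam t = linsum logpot (weight Lam) (distinct_energies Lam) t.
Proof.
move=> nb; rewrite /echo chi_abs2_prod.
have pos k : 0 < 2 + 2 * cos (t * Lam k).
  have : -1 < cos (t * Lam k).
    rewrite lt_neqAle cos_geN1 andbT eq_sym; apply/eqP => ck; apply: nb.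
    apply: (@mem_badset _ (Lam k)); first by rewrite mem_undup map_f// mem_enum.
    by rewrite /bad/= mulrC.
  lra.
have [_ ->] := @ln_prod _ (index_enum _) (fun k => 2 + 2 * cos (t * Lam k)) (fun k _ => pos k).
rewrite (@sum_distinct _ L Lam (fun v => ln (2 + 2 * cos (t * v)))).
rewrite mulr_suml /linsum; apply: eq_bigr => v _.
by rewrite /weight /logpot (mulrC v t) mulrAC.
Qed.

Lemma continuous_chi_abs2 (E0 : R) (L : nat) (Lam : 'I_L -> R) :
  continuous (chi_abs2 E0 Lam).
Proof.
rewrite (_ : chi_abs2 E0 Lam = fun t => \prod_(k < L) (2 + 2 * cos (t * Lam k))); last first.
  by apply/funext => t; exact: chi_abs2_prod.
have ck k : continuous (fun t : R => 2 + 2 * cos (t * Lam k)).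
  rewrite (_ : (fun t => _) = fun t => 2 + 2 * cos (Lam k * t + 0)).
    move=> t; apply: cvgD; first exact: cvg_cst.
    by apply: cvgM; [exact: cvg_cst|exact: continuous_cos_affine].
  by apply/funext => t; rewrite addr0 (mulrC t).
elim: (index_enum _) => [|k r IH] t.
  by under eq_fun do rewrite big_nil; exact: cvg_cst.
by under eq_fun do rewrite big_cons; apply: cvgM; [exact: ck|exact: IH].
Qed.

Lemma measurable_echo (E0 : R) (L : nat) (Lam : 'I_L -> R) :
  measurable_fun setT (echo E0 Lam).
Proof.
apply: measurable_funM => //.
apply: (@measurableT_comp _ _ _ _ _ _ (@ln R)); first exact: measurable_ln.
by apply: measurable_continuousR; exact: continuous_chi_abs2.
Qed.

Lemma measurable_linsum_logpot (c : R -> R) s : measurable_fun setT (linsum logpot c s).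
Proof.
elim: s => [|v s IH].
  rewrite (_ : linsum _ _ _ = fun=> 0) //.
  by apply/funext => t; rewrite /linsum big_nil.
rewrite (_ : linsum _ _ _ = fun t => c v * logpot (v * t) + linsum logpot c s t).
  by apply: measurable_funD => //; apply: measurable_funM => //; exact: measurable_logpot.
by apply/funext => t; rewrite linsum_cons.
Qed.

Lemma weight_powR_le (q : R) (L : nat) (Lam : 'I_L -> R) v : 2 < q -> (0 < L)%N ->
  v \in distinct_energies Lam -> weight Lam v `^ q <= S_q q Lam.
Proof.
move=> q2 L0 vs; have g0 := sum_g2_gt0 Lam L0.
have sq0 : 0 < Num.sqrt (sum_g2 Lam) by rewrite sqrtr_gt0.
have sq : sum_g2 Lam `^ (q / 2) = Num.sqrt (sum_g2 Lam) `^ q.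
  by rewrite -powR12_sqrt ?(ltW g0)// -powRrM mulrC.
have -> : weight Lam v `^ q = (mult Lam v)%:R `^ q / (sum_g2 Lam) `^ (q / 2).
  have -> : (mult Lam v)%:R = weight Lam v * Num.sqrt (sum_g2 Lam).
    by rewrite divfK// gt_eqF.
  by rewrite sq powRM ?weight_ge0 ?sqrtr_ge0// mulfK// gt_eqF// powR_gt0.
rewrite /S_q ler_wpM2r ?invr_ge0 ?powR_ge0//.
by apply: (le_sum_mem (f := fun v => (mult Lam v)%:R `^ q)) => // x; exact: powR_ge0.
Qed.

End EchoLaw.

Unset Implicit Arguments.

Theorem theorem5 (R : realType) (E0 : nat -> R) (Lam : forall L : nat, 'I_L -> R)
  (q : R) :
  (forall L : nat, Q_lin_indep (distinct_energies (Lam L))) ->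
  2 < q ->
  (fun L : nat => S_q q (Lam L)) @ \oo --> (0 : R) ->
  time_avg_cvg_in_law_normal
    (fun (L : nat) (t : R) =>
       ln (chi_abs2 (E0 L) (Lam L) t) / Num.sqrt (sum_g2 (Lam L)))
    (pi / Num.sqrt 3).
Proof.
move=> indep q2 Sq0.
pose F L := echo (E0 L) (Lam L); pose s L := distinct_energies (Lam L).
pose c L := weight (Lam L).
have inds L : zindep (s L) by apply: Q_lin_indep_zindep; exact: indep.
(* Independence excludes the energy [0], whose term would be the constant [ln 4], of non-zero
   mean. *)
have v0 L v : v \in s L -> v != 0 by exact: (zindep_neq0 (inds L)).
have mF L : measurable_fun setT (F L) by exact: measurable_echo.
have c1 L : \sum_(v <- s L) c L v ^+ 2 <= 1.
  by rewrite sum_weight_sqr; have [->|g0] := eqVneq (sum_g2 (Lam L)) 0;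
    [rewrite mul0r|rewrite divff].
have mN L : measurable (badset (s L)) by exact: badset_measurable.
have N0 L : lebesgue_measure (badset (s L)) = 0%E by apply: badset_null; exact: v0.
have FE L t : ~ badset (s L) t -> linsum logpot (c L) (s L) t = F L t.
  by move=> nb; rewrite /F echo_linsum.
have lX L : lint (linsum logpot (c L) (s L)).
  by apply: lint_linsum => v /v0 vn; exact: lint_logpot.
have lF L : lint (F L).
  apply: (null_lint (mN L) (N0 L) _ (mF L) (FE L) (lX L)).
  exact: measurable_linsum_logpot.
have mS L N : measurable_fun setT (linsum (cospoly (@logcoef R 1) N) (c L) (s L)).
  by apply: measurable_continuousR; exact: (ap_continuous (ap_linsum _ _ _ _)).
have uF L N : um (fun t => F L t - linsum (cospoly (logcoef 1) N) (c L) (s L) t)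
    (Num.sqrt (4 / N.+1%:R)).
  apply: (null_um (mN L) (N0 L) _ _ _ (um_linsum_logpotB N (inds L) (c1 L))).
  - by apply: measurable_funB => //; exact: measurable_linsum_logpot.
  - exact: measurable_funB.
  - by move=> t /FE ->.
have s2 : (pi / Num.sqrt 3) ^+ 2 = pi ^+ 2 / 3 :> R by rewrite exprMn exprVn sqr_sqrtr.
have nz : pi / Num.sqrt 3 != 0 :> R.
  by rewrite mulf_neq0 ?invr_eq0 ?gt_eqF ?pi_gt0 ?sqrtr_gt0.
(* The first moment bound [2] is the truncation bound at [N = 0]: the polynomial is then empty and
   the bound reads [sqrt 4]. *)
apply: (@levy _ F _ 2 nz) => // [L|xi al].
  have := uF L 0%N; rewrite divr1 (_ : 4 = 2 ^+ 2); last by ring.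
  rewrite sqrtr_sqr ger0_norm//.
  rewrite (_ : (fun t => _) = F L)//; apply/funext => t.
  rewrite (_ : linsum _ _ _ _ = 0) ?subr0//.
  by rewrite /linsum big1// => v _; rewrite /cospoly big_ord0 mulr0.
rewrite s2; apply: (@clt_cos _ F s c xi al mF inds c1) => //.
  near=> L; rewrite sum_weight_sqr divff// gt_eqF// sum_g2_gt0//.
  by near: L; exact: nbhs_infty_gt.
move=> eta eta0; near=> L => v vs.
have L0 : (0 < L)%N by near: L; exact: nbhs_infty_gt.
(* The threshold [eta ^ q] is chosen so that, powers being increasing, every weight is at most
   [eta]. *)
have Sq : S_q q (Lam L) < eta `^ q.
  by near: L; apply: (cvgr_lt _ Sq0); exact: powR_gt0.
rewrite ger0_norm ?weight_ge0// leNgt; apply/negP => lt_eta.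
have := le_lt_trans (weight_powR_le q2 L0 vs) Sq.
have q0 : 0 <= q by lra.
by rewrite ltNge ge0_ler_powR ?nnegrE ?weight_ge0// ltW.
Unshelve. all: by end_near. Qed.
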